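(* Let $\operatorname{char}\mathbb{K}=p>0$, let $n\ge 2$ with $p\mid n$, suppose $\mathcal{E}_{gh}\ne 0$, and let $1\le j\le p-2$ and $d_j\ge d_{j-1}\ge\cdots\ge d_1\ge 1$ be integers. Then $\overline{\mathcal{T}}_n(p;d_j,d_{j-1},\ldots,d_1)$ has GK-dimension $p-2-j$, with a PBW basis $$\{h^{n_2}\mathcal{E}_{\omega_{p-2}}^{n_{\omega_{p-2}}}\mathcal{E}_{\omega_{p-3}}^{n_{\omega_{p-3}}}\cdots\mathcal{E}_{\omega_1}^{n_{\omega_1}}g^{n_1}\mid 0\le n_2\le p-1,\ 0\le n_{\omega_k}\le p^{d_k}-1\ (1\le k\le j),\ n_{\omega_{k'}}\in\mathbb{N}\ (j<k'\le p-2),\ 0\le n_1\le n-1\}$$ and the relations $$g^n=1,\qquad \mathcal{E}_{\omega_k}^{p^{d_k}}=0,\qquad h^p=0,$$ $$\mathcal{E}_{\omega_s}h=h\mathcal{E}_{\omega_s}+\mathcal{E}_{\omega_{s+1}},\qquad \mathcal{E}_{\omega_{p-2}}h=h\mathcal{E}_{\omega_{p-2}},\qquad \mathcal{E}_{\omega_s}\mathcal{E}_{\omega_t}=\mathcal{E}_{\omega_t}\mathcal{E}_{\omega_s},$$ where $1\le k\le j$ and $0\le s<t\le p-2$.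
   Context: $\mathbb{K}$ is a field, $\mathbb{N}=\{0,1,2,\ldots\}$, and $[a,b]=ab-ba$. On words in the letters $g,h$ use the lexicographic order with $g\prec h$ (a proper prefix of a word is smaller than the word). A Lyndon word is a nonempty word $\alpha$ which is a single letter or satisfies $\alpha\prec\gamma\beta$ for every factorization $\alpha=\beta\gamma$ into nonempty words. $\alpha(g)$ is the number of occurrences of $g$ in $\alpha$. The standard factorization of a Lyndon word $\alpha$ of length at least $2$ is $\alpha=\beta\gamma$ with $\beta,\gamma$ Lyndon and $\gamma$ of maximal length. Define $E_g=g$, $E_h=h$ and $E_\alpha=[E_\beta,E_\gamma]$ for the standard factorization $\alpha=\beta\gamma$. $\mathcal{T}=\mathbb{K}\langle g,h\rangle$ is the free algebra, and $\overline{\mathcal{T}}=\mathcal{T}/\mathcal{I}$ where $\mathcal{I}$ is the ideal generated by all $E_\alpha$ with $\alpha$ Lyndon and $\alpha(g)\ge 2$. For $k\ge 0$, $\omega_k=gh^k$, so $E_{\omega_0}=g$, $E_{\omega_1}=E_{gh}=[g,h]$, $E_{\omega_k}=[E_{\omega_{k-1}},h]$; in any quotient of $\mathcal{T}$, $g,h,\mathcal{E}_{\omega_k}$ denote the images of $g,h,E_{\omega_k}$ (so $\mathcal{E}_{\omega_0}=g$, $\mathcal{E}_{gh}=\mathcal{E}_{\omega_1}$). $\overline{\mathcal{T}}_n=\overline{\mathcal{T}}/(g^n-1)$ (the hypothesis $\mathcal{E}_{gh}\ne0$ refers to $\overline{\mathcal{T}}_n$), $\overline{\mathcal{T}}_n'(p)=\overline{\mathcal{T}}_n/(\mathcal{E}_{\omega_{p-1}})$,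 $\overline{\mathcal{T}}_n(p)=\overline{\mathcal{T}}_n'(p)/(h^p)$, and $\overline{\mathcal{T}}_n(p;d_j,\ldots,d_1)=\overline{\mathcal{T}}_n(p)/(\mathcal{E}_{\omega_k}^{p^{d_k}}\mid 1\le k\le j)$. A PBW basis means that the displayed ordered monomials form a $\mathbb{K}$-vector space basis. GK-dimension is Gelfand–Kirillov dimension. *)

(* Defs.v *)
From HB Require Import structures.
From mathcomp Require Import all_boot all_order all_algebra.
From mathcomp Require Import boolp classical_sets reals ereal topology.
From mathcomp Require Import normedtype sequences exp.
From mathcomp.multinomials Require Import -(notations) monalg.

Set Implicit Arguments.
Unset Strict Implicit.
Unset Printing Implicit Defensive.
Import Order.TTheory GRing.Theory Num.Theory.
Local Open Scope classical_set_scope.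
Local Open Scope ring_scope.

(* Unital associative K-algebras: rings with a ring morphism from K to the
   centre. Unlike the library's [algType] they may be zero, since 1 != 0 is not
   known in advance in a quotient. *)
HB.mixin Record PzRing_isPzAlgebra (K : fieldType) A of GRing.PzRing A := {
  scal : K -> A;
  scal_is_zmod_morphism : zmod_morphism scal;
  scal_is_monoid_morphism : monoid_morphism scal;
  scal_central : forall a x, scal a * x = x * scal a
}.

#[short(type="pzAlgType")]
HB.structure Definition PzAlgebra (K : fieldType) :=
  { A of GRing.PzRing A & PzRing_isPzAlgebra K A }.

Arguments scal {K s} : rename.

(* The underlying vector space of an algebra. It is an alias because no library
   structure joins [pzRingType] and [lmodType]. *)
Definition vect_of (K : fieldType) (A : pzAlgType K) : Type := A.

Arguments vect_of {K} A.

Section VectOf.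
Variables (K : fieldType) (A : pzAlgType K).

HB.instance Definition _ := GRing.isZmodMorphism.Build K A scal
  scal_is_zmod_morphism.
HB.instance Definition _ := GRing.isMonoidMorphism.Build K A scal
  scal_is_monoid_morphism.

HB.instance Definition _ := GRing.Zmodule.on (vect_of A).

Definition vect_scale (a : K) (x : vect_of A) : vect_of A := scal a * (x : A).

Fact vect_scaleA a b x : vect_scale a (vect_scale b x) = vect_scale (a * b) x.
Proof. by rewrite /vect_scale rmorphM mulrA. Qed.

Fact vect_scale1 : left_id 1 vect_scale.
Proof. by move=> x; rewrite /vect_scale rmorph1 mul1r. Qed.

Fact vect_scaleDr : right_distributive vect_scale +%R.
Proof. by move=> a x y; rewrite /vect_scale mulrDr. Qed.

Fact vect_scaleDl x : {morph vect_scale^~ x : a b / a + b}.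
Proof. by move=> a b; rewrite /vect_scale rmorphD mulrDl. Qed.

HB.instance Definition _ := GRing.Zmodule_isLmodule.Build K (vect_of A)
  vect_scaleA vect_scale1 vect_scaleDr vect_scaleDl.

End VectOf.

Section AlgQuotient.
Variables (K : fieldType) (A : pzAlgType K).

Definition ideal2_closed (I : set A) : Prop :=
  [/\ I 0, (forall x y, I x -> I y -> I (x - y)),
      (forall a x, I x -> I (a * x)) & (forall a x, I x -> I (x * a))].

Definition ideal_gen (S : set A) : set A := smallest ideal2_closed S.

Lemma ideal_gen_closed (S : set A) : ideal2_closed (ideal_gen S).
Proof.
split=> [I [[I0 _ _ _] _] //|x y Sx Sy I II|a x Sx I II|a x Sx I II].
- by case: (II.1) => _ + _ _; apply; [exact: Sx|exact: Sy].
- by case: (II.1) => _ _ + _; apply; exact: Sx.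
- by case: (II.1) => _ _ _; apply; exact: Sx.
Qed.

Variable S : set A.

Definition ideal_pred : pred A := fun x => `[< ideal_gen S x >].

Fact ideal_pred_zmod : zmod_closed ideal_pred.
Proof.
have [S0 SB _ _] := ideal_gen_closed S; split; first exact/asboolT.
by move=> x y /asboolP Sx /asboolP Sy; apply/asboolP; apply: (SB _ _ Sx Sy).
Qed.

HB.instance Definition _ := GRing.isZmodClosed.Build A ideal_pred
  ideal_pred_zmod.

Definition ideal_closed : zmodClosed A :=
  GRing.ZmodClosed.clone A ideal_pred _.

Definition alg_quot : Type := Quotient.quot ideal_closed.

HB.instance Definition _ := GRing.Zmodule.on alg_quot.

Definition to_quot (x : A) : alg_quot := (\pi_(Quotient.quot ideal_closed) x)%qT.

Lemma to_quot_surj (u : alg_quot) : exists x, u = to_quot x.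
Proof. by exists (repr (u : Quotient.quot ideal_closed)); rewrite /to_quot reprK. Qed.

Lemma to_quot_eq x y : to_quot x = to_quot y <-> ideal_gen S (x - y).
Proof.
split=> [/eqP|Sxy]; first by rewrite /to_quot -Quotient.idealrBE => /asboolP.
by apply/eqP; rewrite /to_quot -Quotient.idealrBE; exact/asboolP.
Qed.

Lemma to_quotB : {morph to_quot : x y / x - y >-> x - y}.
Proof. by move=> x y; rewrite /to_quot raddfB. Qed.

Lemma to_quotD : {morph to_quot : x y / x + y >-> x + y}.
Proof. by move=> x y; rewrite /to_quot raddfD. Qed.

Definition quot_repr (u : alg_quot) : A :=
  repr (u : Quotient.quot ideal_closed).

Lemma quot_reprK : cancel quot_repr to_quot.
Proof. by move=> u; rewrite /to_quot /quot_repr reprK. Qed.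

Definition quot_one : alg_quot := to_quot 1.
Definition quot_mul (u v : alg_quot) : alg_quot :=
  to_quot (quot_repr u * quot_repr v).

Lemma to_quotM x y : to_quot (x * y) = quot_mul (to_quot x) (to_quot y).
Proof.
have [I0 SB Sl Sr] := ideal_gen_closed S.
have S0 z : ideal_gen S (z - quot_repr (to_quot z)).
  by apply/to_quot_eq; rewrite quot_reprK.
apply/to_quot_eq; set x' := quot_repr _; set y' := quot_repr _.
rewrite (_ : _ - _ = x * (y - y') - (x' - x) * y'); last first.
  by rewrite mulrBr mulrBl opprB addrA subrK.
apply: (SB _ _ (Sl _ _ (S0 y))); apply: (Sr).
by rewrite -opprB -[- _]add0r; apply: (SB _ _ _ (S0 x)).
Qed.

Fact quot_mulA : associative quot_mul.
Proof.
move=> u v w; have [x ->] := to_quot_surj u; have [y ->] := to_quot_surj v.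
by have [z ->] := to_quot_surj w; rewrite -!to_quotM mulrA.
Qed.

Fact quot_mul1 : left_id quot_one quot_mul.
Proof. by move=> u; have [x ->] := to_quot_surj u; rewrite -to_quotM mul1r. Qed.

Fact quot_mulr1 : right_id quot_one quot_mul.
Proof. by move=> u; have [x ->] := to_quot_surj u; rewrite -to_quotM mulr1. Qed.

Fact quot_mulDl : left_distributive quot_mul +%R.
Proof.
move=> u v w; have [x ->] := to_quot_surj u; have [y ->] := to_quot_surj v.
have [z ->] := to_quot_surj w.
by rewrite -to_quotD -!to_quotM -to_quotD mulrDl.
Qed.

Fact quot_mulDr : right_distributive quot_mul +%R.
Proof.
move=> u v w; have [x ->] := to_quot_surj u; have [y ->] := to_quot_surj v.
have [z ->] := to_quot_surj w.
by rewrite -to_quotD -!to_quotM -to_quotD mulrDr.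
Qed.

HB.instance Definition _ := GRing.Zmodule_isPzRing.Build alg_quot
  quot_mulA quot_mul1 quot_mulr1 quot_mulDl quot_mulDr.

Fact to_quot_monoid_morphism : monoid_morphism to_quot.
Proof. by split=> // x y; rewrite to_quotM. Qed.

Fact to_quot_zmod_morphism : zmod_morphism to_quot.
Proof. exact: to_quotB. Qed.

HB.instance Definition _ := GRing.isZmodMorphism.Build A alg_quot to_quot
  to_quot_zmod_morphism.
HB.instance Definition _ := GRing.isMonoidMorphism.Build A alg_quot to_quot
  to_quot_monoid_morphism.

Definition quot_scal (a : K) : alg_quot := to_quot (scal a).

Fact quot_scal_zmod_morphism : zmod_morphism quot_scal.
Proof. by move=> a b; rewrite /quot_scal rmorphB to_quotB. Qed.

Fact quot_scal_monoid_morphism : monoid_morphism quot_scal.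
Proof. by split=> [|a b]; rewrite /quot_scal ?rmorph1 ?rmorphM. Qed.

Fact quot_scal_central a u : quot_scal a * u = u * quot_scal a.
Proof.
have [x ->] := to_quot_surj u.
by rewrite /quot_scal -!(rmorphM to_quot) scal_central.
Qed.

HB.instance Definition _ := PzRing_isPzAlgebra.Build K alg_quot
  quot_scal_zmod_morphism quot_scal_monoid_morphism quot_scal_central.

End AlgQuotient.

Section Dimension.
Variables (K : fieldType) (V : lmodType K).

Definition linspan (W : set V) : set V :=
  [set v | exists s : seq (K * V),
     (forall x, x \in s -> W x.2) /\ v = \sum_(x <- s) x.1 *: x.2].

Definition family_free (I : eqType) (D : set I) (b : I -> V) : Prop :=
  forall (s : seq I) (c : I -> K),
    uniq s -> (forall i, i \in s -> D i) ->
    \sum_(i <- s) c i *: b i = 0 -> forall i, i \in s -> c i = 0.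

Definition family_basis (I : eqType) (D : set I) (b : I -> V) : Prop :=
  family_free D b /\ linspan (b @` D) = setT.

(* the dimension of the subspace W, +oo if it is infinite *)
Definition vdim (R : realType) (W : set V) : \bar R :=
  ereal_sup [set (size s)%:R%:E | s in
    [set s : seq V | (forall x, x \in s -> W x) /\
       family_free [set i | (i < size s)%N] (nth 0 s)]].

End Dimension.

Section GelfandKirillov.
Variables (R : realType) (K : fieldType) (A : pzAlgType K).

(* K + V + V^2 + ... + V^m, where V is the span of X *)
Definition growth (X : seq A) (m : nat) : set (vect_of A) :=
  linspan (V := vect_of A) [set \prod_(x <- s) x | s in
    [set s : seq A | (size s <= m)%N /\ {subset s <= X}]].

(* sup over finite-dimensional subspaces V of
   limsup_m log (dim (K + V + ... + V^m)) / log m *)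
Definition GKdim : \bar R :=
  ereal_sup [set limn_esup (fun m : nat =>
      lne (vdim R (growth X m)) * ((ln m%:R)^-1)%:E)%E | X in [set: seq A]].

End GelfandKirillov.

(* The letter g is [false] and the letter h is [true]. [seqlexi] carries the
   lexicographic order, with false < true and proper prefixes smaller. *)
Definition word := seqlexi bool.

(* i is the length of the first factor of a factorization of w *)
Definition lyndon (w : word) : bool :=
  (w != [::]) &&
  [forall i : 'I_(size w),
     (0 < i)%N ==> (w < (drop i w ++ take i w : word))%O].

(* length of the left factor of the standard factorization: the right factor
   is longest when the left one is shortest *)
Definition std_cut (w : word) : nat :=
  (find (fun i => lyndon (take i w) && lyndon (drop i w))
        (iota 1 (size w).-1)).+1.

Definition omega (k : nat) : word := false :: nseq k true.

Definition comm (A : pzRingType) (a b : A) : A := a * b - b * a.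

Section FreeAlgebra.
Variable K : fieldType.

Definition free_alg : Type := malg (fmonom bool) K.

HB.instance Definition _ := GRing.Lalgebra.on free_alg.

Fact free_scal_central (a : K) (x : free_alg) : a%:A * x = x * a%:A.
Proof.
rewrite mulr_algl -mul_malgC -[a%:A]mul_malgC mulr1.
rewrite !malgM_def fgmulUg fgmulgU.
by apply: eq_bigr => k _; rewrite mul1m mulm1 mulrC.
Qed.

HB.instance Definition _ := PzRing_isPzAlgebra.Build K free_alg
  (raddfB (in_alg free_alg)) (rmorphism_monoidP (in_alg free_alg)) free_scal_central.

Definition gen (b : bool) : free_alg := mkmalgU (fmu b) 1.

(* the first argument bounds the depth of the recursion; the value is
   meaningful for Lyndon words only *)
Fixpoint lyndon_elt_rec (N : nat) (w : word) : free_alg :=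
  match N, w with
  | N'.+1, [:: b] => gen b
  | N'.+1, _ => comm (lyndon_elt_rec N' (take (std_cut w) w))
                     (lyndon_elt_rec N' (drop (std_cut w) w))
  | 0, _ => 0
  end.

Definition lyndon_elt (w : word) : free_alg := lyndon_elt_rec (size w) w.

End FreeAlgebra.

Section Tower.
Variable K : fieldType.
Local Notation T := (free_alg K).
Local Notation g := (gen K false).
Local Notation h := (gen K true).
Local Notation E k := (lyndon_elt K (omega k)).

Definition Tbar := alg_quot
  [set lyndon_elt K w | w in
     [set w : word | lyndon w /\ (2 <= count_mem false w)%N]].
HB.instance Definition _ := PzAlgebra.on Tbar.
Definition pr_bar (x : T) : Tbar := to_quot _ x.

Variable n : nat.

Definition Tbar_n := alg_quot [set pr_bar g ^+ n - 1].
HB.instance Definition _ := PzAlgebra.on Tbar_n.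
Definition pr_n (x : T) : Tbar_n := to_quot _ (pr_bar x).

Variable p : nat.

Definition Tbar_n' := alg_quot [set pr_n (E p.-1)].
HB.instance Definition _ := PzAlgebra.on Tbar_n'.
Definition pr_n' (x : T) : Tbar_n' := to_quot _ (pr_n x).

Definition Tbar_np := alg_quot [set pr_n' h ^+ p].
HB.instance Definition _ := PzAlgebra.on Tbar_np.
Definition pr_np (x : T) : Tbar_np := to_quot _ (pr_n' x).

Variables (j : nat) (d : nat -> nat).

Definition Tbar_npd := alg_quot
  [set pr_np (E k) ^+ (p ^ d k)%N | k in [set k | (1 <= k <= j)%N]].
HB.instance Definition _ := PzAlgebra.on Tbar_npd.
Definition pr_npd (x : T) : Tbar_npd := to_quot _ (pr_np x).

(* exponents (n_2, e, n_1), with e i the exponent of E_(omega_(i+1)) *)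
Definition pbw_index : Type := (nat * {ffun 'I_(p - 2) -> nat} * nat)%type.

Definition pbw_range : set pbw_index :=
  [set x : pbw_index | [/\ (x.1.1 < p)%N,
    forall i : 'I_(p - 2), (i < j)%N -> (x.1.2 i < p ^ d i.+1)%N
  & (x.2 < n)%N]].

(* the exponents of E_(omega_(p-2)), ..., E_(omega_1) in decreasing order *)
Definition pbw_monomial (x : pbw_index) : Tbar_npd :=
  pr_npd h ^+ x.1.1
  * (\prod_(i < p - 2) pr_npd (E (rev_ord i).+1) ^+ x.1.2 (rev_ord i))
  * pr_npd g ^+ x.2.

Definition pbw_relations : set T :=
  [set g ^+ n - 1; h ^+ p]
  `|` [set E k ^+ (p ^ d k)%N | k in [set k | (1 <= k <= j)%N]]
  `|` [set E s * h - (h * E s + E s.+1) | s in [set s | (s < p - 2)%N]]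
  `|` [set E (p - 2)%N * h - h * E (p - 2)%N]
  `|` [set E st.1 * E st.2 - E st.2 * E st.1 | st in
        [set st : nat * nat | (st.1 < st.2 <= p - 2)%N]].

End Tower.

Arguments pbw_range n p j d : clear implicits.
Arguments pbw_monomial K n p j d : clear implicits.
Arguments pbw_relations K n p j d : clear implicits.
Arguments GKdim R {K} A.

(* Main.v *)
From HB Require Import structures.
Require Import Defs.
From mathcomp Require Import all_boot all_order all_algebra.
From mathcomp Require Import boolp classical_sets reals ereal topology.
From mathcomp Require Import normedtype sequences exp.
From mathcomp.multinomials Require Import -(notations) monalg.

Set Implicit Arguments.
Unset Strict Implicit.
Import Order.TTheory GRing.Theory Num.Theory.
Local Open Scope classical_set_scope.
Local Open Scope ring_scope.

(** The algebra is an iterated skew extension. Write x_k for the image of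
    E_(omega_k), so that x_0 = g. Killing all E_w with two or more letters g in
    w amounts to making the x_k commute, and x_(k+1) = [x_k, h] says that h acts
    on the commutative algebra of the x_k as a derivation x_k |-> x_(k+1). The
    further relations g^n = 1, x_(p-1) = 0, x_k^(p^(d_k)) = 0 and h^p = 0 are
    compatible with that derivation: p-th powers have zero derivative in
    characteristic p, and p divides n. So no relation collapses the basis.

    Presentation. The iterated quotient is the quotient of the free algebra by
    all defining relations together ([ker_pr_npd]), and they generate the same
    ideal as the relations of the statement ([tower_relationsE]). The point is
    that any E_w with at least two g lies in the ideal generated by the
    commutators of the x_k ([lyndon_elt_ideal]), and conversely these
    commutators are E_w for the Lyndon words w = omega_s omega_t.

    Independence. It is enough to have a representation in which the monomials
    act independently. Let C be the commutative algebra generated by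
    x_0, ..., x_(p-2) with x_0^n = 1, x_k^(p^(d_k)) = 0 for k <= j and, for the
    remaining k, x_k^(N_k) = 0 with N_k a multiple of p larger than all
    exponents under consideration. On C[t]/(t^p) let h act as multiplication by
    t, and let x_k act as the operator sum_i x_(k+i) D^i / i! with D = d/dt,
    that is, exp (D delta) applied to x_k, for the derivation
    delta : x_k |-> x_(k+1). Since [D, t] = 1 also holds modulo t^p, the
    commutator with t differentiates the operator with respect to D, which
    shifts the index k. By Frobenius and D^p = 0 the operator and x_k have the
    same p-th power, so all the relations hold. Finally h^a x^e g^b sends 1 to
    t^a x^e g^b ([pbw_model]).

    Spanning and growth. Let W_N be the span of the basis monomials of total
    degree at most N. Rewriting shows that h W_N and x_k W_N lie in W_(N+1)
    ([filt_h], [filt_x]); hence W_M W_N lies in W_(M+N) and the monomials span.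
    A finite set lies in some W_M, so its products of length at most m lie in
    W_(mM), whose dimension is at most a constant times m^(p-2-j): only
    p-2-j exponents are unbounded. For the lower bound take the squarefree
    monomials in x_(j+1), ..., x_(p-2): their products of length at most m
    are all monomials with exponents at most m ([GKdim_filt]). *)

(** * Lyndon words with one or two letters g *)

Lemma ltxi_bool (a b : bool) (s t : word) :
  ((a :: s : word) < (b :: t : word))%O = (a < b)%O || ((a == b) && (s < t)%O).
Proof. by rewrite ltxi_cons; case: a; case: b. Qed.

Lemma lyndonP (w : word) : lyndon w <->
  w != [::] /\
  forall i, (0 < i < size w)%N -> (w < (drop i w ++ take i w : word))%O.
Proof.
split=> [/andP[w0 /forallP H]|[w0 H]].
  by split=> // i /andP[i0 iw]; have /implyP := H (Ordinal iw); apply.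
apply/andP; split=> //; apply/forallP => i; apply/implyP => i0.
by apply: H; rewrite i0 /=.
Qed.

(** A word starting with h has a rotation starting with g, which is smaller,
    unless it is a power of h; and a proper power equals one of its rotations. *)
Lemma lyndon_true (w : word) : lyndon (true :: w : word) -> w = [::].
Proof.
move=> /lyndonP[_ H].
case: (boolP (false \in (w : seq bool))) => [fw|fw].
  have := H (index false w).+1; rewrite /= ltnS index_mem => /(_ fw).
  by rewrite (drop_nth false) ?index_mem // nth_index //= ltxi_bool.
have wE : w = nseq (size w) true.
  by apply/all_pred1P/allP => -[] //; rewrite (negPf fw).
case: (size w) wE H => [//|m] -> H; have := H 1%N.
rewrite /= size_nseq => /(_ isT).
have -> : true :: nseq m true ++ [:: true] = nseq m.+2 true.
  by rewrite -[m.+2]addn1 nseqD.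
by rewrite ltxx.
Qed.

Lemma lyndon_h : lyndon [:: true].
Proof. by apply/lyndonP; split=> // -[|[|i]]. Qed.

Lemma lyndon_omega k : lyndon (omega k).
Proof.
apply/lyndonP; split=> // -[//|i] /andP[_]; rewrite /= size_nseq ltnS => ik.
by rewrite drop_nseq -(subnSK ik) /= ltxi_bool.
Qed.

Lemma lyndon_count1 (w : word) :
  lyndon w -> count_mem false w = 1%N -> exists k, w = omega k.
Proof.
case: w => [//|[] w] lw; first by rewrite (lyndon_true lw).
move=> /= /eqP; rewrite eqSS => c0; exists (size w).
congr cons; apply/all_pred1P/allP => -[] // fw.
by move: c0; rewrite -leqn0 leqNgt -has_count has_pred1 fw.
Qed.

(** [std_cut] takes the first admissible cut, that is, the longest right
    factor. *)
Lemma std_cutE (w : word) m : (0 < m < size w)%N ->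
  lyndon (take m w) -> lyndon (drop m w) ->
  (forall i, (0 < i < m)%N -> ~~ lyndon (drop i w)) -> std_cut w = m.
Proof.
move=> /andP[m0 mw] lt ld H; rewrite /std_cut.
set a := (fun i => _); set r := iota _ _.
have rE : r = iota 1 m.-1 ++ m :: iota m.+1 ((size w).-1 - m).
  rewrite -[m :: _]/(iota m ((size w).-1 - m).+1).
  rewrite -[in iota m _](prednK m0) -add1n -iotaD /r; congr iota.
  case: m {lt ld H a r} m0 mw => //= m _; case: (size w) => //= N.
  by rewrite ltnS => h; rewrite addnS -addSn subnKC.
rewrite rE find_cat ifF ?{1}/a /= ?lt ?ld ?addn0 ?size_iota ?prednK //.
apply/hasP => -[i]; rewrite mem_iota => /andP[i0 im].
by rewrite add1n prednK // in im; rewrite (negPf (H i _)) ?andbF // i0.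
Qed.

Lemma std_cut_omega k : std_cut (omega k.+1) = k.+1.
Proof.
have hk : true :: nseq k true = nseq k.+1 true by [].
apply: std_cutE; rewrite ?size_nseq /= ?size_nseq ?leqnn //.
- by rewrite hk take_nseq // -/(omega k) lyndon_omega.
- by rewrite hk drop_nseq subSn // subnn; exact: lyndon_h.
case=> // i /andP[_]; rewrite ltnS => ik; rewrite /= hk drop_nseq subSn; last exact: ltnW.
by apply/negP => /lyndon_true; rewrite -(subnSK ik).
Qed.

Lemma omega_cat_cut s t : take s.+1 (omega s ++ omega t) = omega s /\
  drop s.+1 (omega s ++ omega t) = omega t.
Proof.
by rewrite take_size_cat ?drop_size_cat //= size_nseq.
Qed.

Lemma std_cut_omega2 s t : std_cut (omega s ++ omega t) = s.+1.
Proof.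
have [tE dE] := omega_cat_cut s t.
apply: std_cutE; rewrite ?tE ?dE ?lyndon_omega //.
  by rewrite size_cat /= size_nseq addnS /= ltnS leq_addr.
case=> // i /andP[_]; rewrite ltnS => si; rewrite /=.
rewrite drop_cat size_nseq si drop_nseq -(subnSK si).
by apply/negP => /lyndon_true /=; case: (s - i.+1)%N.
Qed.

Lemma ltxi_cat (u v w : word) : ((u ++ v : word) < (u ++ w : word))%O = (v < w)%O.
Proof. by elim: u => //= a u IH; rewrite ltxi_bool ltxx eqxx. Qed.

Lemma lyndon_omega2 s t : (s < t)%N -> lyndon (omega s ++ omega t).
Proof.
move=> st; apply/lyndonP; split=> // i /andP[i0].
rewrite size_cat /= !size_nseq ltnS => ilt.
have [tE dE] := omega_cat_cut s t.
case: (ltngtP i s.+1) => [lt|gt|->]; last first.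
- rewrite tE dE /omega /= ltxi_bool /=.
  have -> : nseq t true = nseq s true ++ true :: nseq (t - s.+1) true.
    by rewrite -[in LHS](subnKC st) addSnnS nseqD.
  by rewrite -[X in (_ < X)%O]catA ltxi_cat /= ltxi_bool.
- have -> : drop i (omega s ++ omega t) = drop (i - s.+1) (omega t).
    by rewrite drop_cat /= size_nseq ltnNge (ltnW gt).
  have : (0 < i - s.+1 <= t)%N by rewrite subn_gt0 gt leq_subLR addSnnS.
  case: (i - s.+1)%N => // r; rewrite /= => rt.
  by rewrite drop_nseq -(subnSK rt).
case: i i0 {ilt} lt => // i _; rewrite ltnS => lt /=.
by rewrite drop_cat size_nseq lt drop_nseq -(subnSK lt).
Qed.

(** For a Lyndon word the first alternative always holds. The dichotomy suffices
    and avoids that theorem: an empty right factor makes the element a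
    commutator with 0. *)
Lemma std_cutP (w : word) : (1 < size w)%N ->
  (lyndon (take (std_cut w) w) /\ lyndon (drop (std_cut w) w)) \/
  drop (std_cut w) w = [::].
Proof.
move=> w1; rewrite /std_cut; set a := (fun i => _).
case: (boolP (has a (iota 1 (size w).-1))) => [ha|ha]; [left|right].
  have := nth_find 0%N ha; rewrite nth_iota; last first.
    by rewrite -{2}(size_iota 1 (size w).-1) -has_find.
  by rewrite add1n => /andP[].
by rewrite hasNfind // size_iota prednK ?(ltnW w1) // drop_size.
Qed.

(** The values lie in an abstract ring so that comparing two terms of the
    recursion never starts computing in the free algebra. *)
Section LyndonRecursion.
Variables (R : pzRingType) (x : bool -> R) (rec : nat -> word -> R).
Hypothesis rec_nil : forall N, rec N [::] = 0.
Hypothesis rec1 : forall N b, rec N.+1 [:: b] = x b.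
Hypothesis rec_big : forall N w, (1 < size w)%N ->
  rec N.+1 w = comm (rec N (take (std_cut w) w)) (rec N (drop (std_cut w) w)).

Lemma rec_omegaS N k : (0 < N)%N ->
  rec N.+1 (omega k.+1) = comm (rec N (omega k)) (x true).
Proof.
case: N => // N _; rewrite rec_big ?size_nseq //.
rewrite std_cut_omega /omega /= -[true :: nseq k true]/(nseq k.+1 true).
by rewrite take_nseq // drop_nseq subSn // subnn rec1.
Qed.

Lemma rec_omega N k : (k < N)%N -> rec N (omega k) = rec k.+1 (omega k).
Proof.
elim: k N => [|k IH] [|N] kN //; first by rewrite !rec1.
by rewrite !rec_omegaS ?IH //; exact: leq_ltn_trans (leq0n k) kN.
Qed.

Lemma rec_omega2 s t :
  rec (size (omega s ++ omega t)) (omega s ++ omega t) =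
  comm (rec s.+1 (omega s)) (rec t.+1 (omega t)).
Proof.
have [tE dE] := omega_cat_cut s t.
rewrite size_cat /= !size_nseq addSn rec_big; last by rewrite /= size_cat /= addnS.
rewrite std_cut_omega2 tE dE !(@rec_omega (s + t.+1)) //.
  by rewrite addnS ltnS leq_addl.
by rewrite addnS ltnS leq_addr.
Qed.

(** Induction on the recursion: if one of the two factors has at least two
    letters g, its element is in the ideal; otherwise each factor has exactly
    one g, hence is some [omega k]. *)
Lemma rec_ideal (I : set R) :
  [/\ I 0, (forall a b, I a -> I b -> I (a - b)),
      (forall a b, I b -> I (a * b)) & (forall a b, I b -> I (b * a))] ->
  (forall s t, (s < t)%N -> I (comm (rec s.+1 (omega s)) (rec t.+1 (omega t)))) ->
  forall N (w : word), (size w <= N)%N -> lyndon w ->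
    (2 <= count_mem false w)%N -> I (rec N w).
Proof.
move=> [I0 IB Il Ir] Hc.
have IN a : I a -> I (- a) by move=> Ia; rewrite -sub0r; apply: IB.
have comml a b : I a -> I (comm a b).
  by move=> Ia; apply: IB; [apply: Ir|apply: Il].
have commr a b : I b -> I (comm a b).
  by move=> Ib; apply: IB; [apply: Il|apply: Ir].
have Hst s t : I (comm (rec s.+1 (omega s)) (rec t.+1 (omega t))).
  case: (ltngtP s t) => [|st|->]; first exact: Hc.
    by rewrite /comm -opprB; apply/IN/Hc.
  by rewrite /comm subrr.
elim=> [|N IH] w; first by rewrite leqn0 => /nilP ->.
move=> wN lw cw.
have w1 : (1 < size w)%N by apply: leq_trans cw (count_size _ _).
rewrite rec_big //.
case: (std_cutP w1) => [[lt ld]|->]; last by apply: commr; rewrite rec_nil.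
set c := std_cut w in lt ld *.
have dN : (size (drop c w) <= N)%N.
  by rewrite size_drop leq_subLR /c /std_cut (leq_trans wN) // addSn ltnS leq_addl.
have tN : (size (take c w) <= N)%N.
  have : (0 < size (drop c w))%N by case: (drop c w) ld.
  rewrite size_drop subn_gt0 => cw'; rewrite size_takel; last exact: ltnW.
  by have := leq_trans cw' wN; rewrite ltnS.
have : (count_mem false (take c w) + count_mem false (drop c w) >= 2)%N.
  by rewrite -count_cat cat_take_drop.
case: (ltnP 1 (count_mem false (take c w))) => ct; first by move=> _; apply/comml/IH.
case: (ltnP 1 (count_mem false (drop c w))) => cd; first by move=> _; apply/commr/IH.
move=> cE.
have [ct1 cd1] : count_mem false (take c w) = 1%N /\ count_mem false (drop c w) = 1%N.
  move: cE ct cd; case: (count_mem false (take c w)) => [|[|?]] //;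
  by case: (count_mem false (drop c w)) => [|[|?]].
have [s sE] := lyndon_count1 lt ct1; have [t tE] := lyndon_count1 ld cd1.
move: tN dN; rewrite sE tE /= !size_nseq => sN tN.
by rewrite (rec_omega sN) (rec_omega tN).
Qed.

End LyndonRecursion.

Lemma comm_mul (R : pzRingType) (a b c : R) : c = comm a b -> a * b = b * a + c.
Proof. by move=> ->; rewrite addrC subrK. Qed.

Lemma comm_rel (R : pzRingType) (a b c : R) :
  c = comm a b -> a * b - (b * a + c) = 0.
Proof. by move=> /comm_mul ->; rewrite subrr. Qed.

Lemma rmorph_comm (R S : pzRingType) (f : {rmorphism R -> S}) (a b : R) :
  f (comm a b) = comm (f a) (f b).
Proof. by rewrite rmorphB !rmorphM. Qed.

Section LyndonElements.
Variable K : fieldType.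
Local Notation T := (free_alg K).
Local Notation E k := (lyndon_elt K (omega k)).

Fact lyndon_elt_rec_nil N : lyndon_elt_rec K N [::] = 0.
Proof. by case: N => [|N] //; rewrite [LHS]subrr. Qed.

Fact lyndon_elt_rec1 N b : lyndon_elt_rec K N.+1 [:: b] = gen K b.
Proof. by []. Qed.

Fact lyndon_elt_rec_big N (w : word) : (1 < size w)%N ->
  lyndon_elt_rec K N.+1 w = comm (lyndon_elt_rec K N (take (std_cut w) w))
                                 (lyndon_elt_rec K N (drop (std_cut w) w)).
Proof. by case: w => [|a [|b w]]. Qed.

Fact lyndon_elt_omegaE k : E k = lyndon_elt_rec K k.+1 (omega k).
Proof. by rewrite /lyndon_elt [size _]/= size_nseq. Qed.

Lemma lyndon_elt_omega0 : E 0 = gen K false.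
Proof. exact: lyndon_elt_rec1. Qed.

Lemma lyndon_elt_omegaS k : E k.+1 = comm (E k) (gen K true).
Proof.
rewrite !lyndon_elt_omegaE.
exact: (rec_omegaS lyndon_elt_rec1 lyndon_elt_rec_big).
Qed.

Lemma lyndon_elt_omega_rel k :
  E k * gen K true - (gen K true * E k + E k.+1) = 0.
Proof. exact: comm_rel (lyndon_elt_omegaS k). Qed.

Lemma lyndon_elt_omega2 s t :
  lyndon_elt K (omega s ++ omega t) = comm (E s) (E t).
Proof.
rewrite !lyndon_elt_omegaE.
exact: (rec_omega2 lyndon_elt_rec1 lyndon_elt_rec_big).
Qed.

Lemma lyndon_elt_ideal (I : set T) : ideal2_closed I ->
  (forall s t, (s < t)%N -> I (comm (E s) (E t))) ->
  forall w : word, lyndon w -> (2 <= count_mem false w)%N -> I (lyndon_elt K w).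
Proof.
move=> II Hc w lw cw; rewrite /lyndon_elt.
have Hc' s t : (s < t)%N -> I (comm (lyndon_elt_rec K s.+1 (omega s))
                                    (lyndon_elt_rec K t.+1 (omega t))).
  by rewrite -!lyndon_elt_omegaE; apply: Hc.
exact: (rec_ideal lyndon_elt_rec_nil lyndon_elt_rec1 lyndon_elt_rec_big II Hc'
  (leqnn _) lw cw).
Qed.

End LyndonElements.

(** * The iterated quotient as one quotient *)

Section Ideals.
Variables (K : fieldType) (A : pzAlgType K).
Implicit Types S I : set A.

Lemma ideal_gen_incl S : S `<=` ideal_gen S.
Proof. exact: sub_gen_smallest. Qed.

Lemma ideal_gen_min S I : ideal2_closed I -> S `<=` I -> ideal_gen S `<=` I.
Proof. by move=> idI SI x; apply; split. Qed.

Lemma ideal_gen_mono S S' : S `<=` S' -> ideal_gen S `<=` ideal_gen S'.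
Proof.
move=> SS'; apply: ideal_gen_min; first exact: ideal_gen_closed.
exact: subset_trans SS' (@ideal_gen_incl S').
Qed.

Lemma to_quot_eq0 S x : to_quot S x = 0 <-> ideal_gen S x.
Proof. by have := to_quot_eq S x 0; rewrite rmorph0 subr0. Qed.

Lemma to_quot_gen S x : S x -> to_quot S x = 0.
Proof. by move=> Sx; apply/to_quot_eq0; apply: ideal_gen_incl. Qed.

Lemma ideal2_ker (B : pzRingType) (f : {rmorphism A -> B}) :
  ideal2_closed [set x | f x = 0].
Proof.
split=> [|x y /= fx fy|a x /= fx|a x /= fx]; rewrite /= ?rmorph0 //.
- by rewrite rmorphB fx fy subrr.
- by rewrite rmorphM fx mulr0.
- by rewrite rmorphM fx mul0r.
Qed.

End Ideals.

(** Third isomorphism theorem: by surjectivity the image under [f] of an ideal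
    is an ideal, so the preimage of the ideal generated by [f @` S'] is generated
    by [S'] and the kernel. *)
Lemma ker_to_quot (K : fieldType) (A B : pzAlgType K)
    (f : {rmorphism A -> B}) (R S' : set A) (S : set B) :
  (forall u, exists x, u = f x) ->
  (forall x, f x = 0 <-> ideal_gen R x) -> S = f @` S' ->
  forall x, to_quot S (f x) = 0 <-> ideal_gen (R `|` S') x.
Proof.
move=> fsurj kerf -> x; have [J0 JB Jl Jr] := ideal_gen_closed (R `|` S').
split.
  move=> /to_quot_eq0 Sfx.
  suff [y Jy fyx] : (f @` ideal_gen (R `|` S')) (f x).
    have JR : ideal_gen (R `|` S') (x - y).
      apply: ideal_gen_mono (@subsetUl _ _ _) _ _.
      by apply/kerf; rewrite rmorphB fyx subrr.
    have := JB _ _ JR (JB _ _ J0 Jy); rewrite sub0r opprK subrK.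
    exact.
  apply: ideal_gen_min Sfx.
    split=> [|_ _ [y Jy <-] [z Jz <-]|b _ [y Jy <-]|b _ [y Jy <-]].
    - by exists 0 => //; rewrite rmorph0.
    - by exists (y - z); [exact: JB|rewrite rmorphB].
    - by have [a ->] := fsurj b; exists (a * y); [exact: Jl|rewrite rmorphM].
    - by have [a ->] := fsurj b; exists (y * a); [exact: Jr|rewrite rmorphM].
  by move=> _ [y Sy <-]; exists y => //; apply: ideal_gen_incl; right.
move=> Jx; suff: [set x | (to_quot (f @` S') \o f) x = 0] x by [].
apply: (ideal_gen_min _ _ Jx); first exact: ideal2_ker.
move=> y [Ry|Sy] /=; last by apply: to_quot_gen; exists y.
by have /kerf -> := ideal_gen_incl Ry; rewrite rmorph0.
Qed.

Section TowerMorphisms.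
Variables (K : fieldType) (n p j : nat) (d : nat -> nat).

HB.instance Definition _ := GRing.isZmodMorphism.Build (free_alg K) (Tbar K)
  (@pr_bar K) (rmorphB (to_quot _)).
HB.instance Definition _ := GRing.isMonoidMorphism.Build (free_alg K) (Tbar K)
  (@pr_bar K) (rmorphism_monoidP (to_quot _)).

HB.instance Definition _ := GRing.isZmodMorphism.Build (free_alg K) (Tbar_n K n)
  (@pr_n K n) (rmorphB (to_quot _ \o @pr_bar K)).
HB.instance Definition _ := GRing.isMonoidMorphism.Build (free_alg K) (Tbar_n K n)
  (@pr_n K n) (rmorphism_monoidP (to_quot _ \o @pr_bar K)).

HB.instance Definition _ := GRing.isZmodMorphism.Build (free_alg K) (Tbar_n' K n p)
  (@pr_n' K n p) (rmorphB (to_quot _ \o @pr_n K n)).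
HB.instance Definition _ := GRing.isMonoidMorphism.Build (free_alg K) (Tbar_n' K n p)
  (@pr_n' K n p) (rmorphism_monoidP (to_quot _ \o @pr_n K n)).

HB.instance Definition _ := GRing.isZmodMorphism.Build (free_alg K) (Tbar_np K n p)
  (@pr_np K n p) (rmorphB (to_quot _ \o @pr_n' K n p)).
HB.instance Definition _ := GRing.isMonoidMorphism.Build (free_alg K) (Tbar_np K n p)
  (@pr_np K n p) (rmorphism_monoidP (to_quot _ \o @pr_n' K n p)).

HB.instance Definition _ := GRing.isZmodMorphism.Build (free_alg K) (Tbar_npd K n p j d)
  (@pr_npd K n p j d) (rmorphB (to_quot _ \o @pr_np K n p)).
HB.instance Definition _ := GRing.isMonoidMorphism.Build (free_alg K) (Tbar_npd K n p j d)
  (@pr_npd K n p j d) (rmorphism_monoidP (to_quot _ \o @pr_np K n p)).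

End TowerMorphisms.

Section Relations.
Variables (K : fieldType) (n p j : nat) (d : nat -> nat).
Local Notation T := (free_alg K).
Local Notation g := (gen K false).
Local Notation h := (gen K true).
Local Notation E k := (lyndon_elt K (omega k)).

Definition lyndon_relations : set T := [set lyndon_elt K w | w in
  [set w : word | lyndon w /\ (2 <= count_mem false w)%N]].

Definition tower_relations : set T :=
  lyndon_relations `|` [set g ^+ n - 1] `|` [set E p.-1] `|` [set h ^+ p]
  `|` [set E k ^+ (p ^ d k)%N | k in [set k | (1 <= k <= j)%N]].

Lemma pr_bar_surj (u : Tbar K) : exists x, u = pr_bar x.
Proof. exact: to_quot_surj. Qed.

Lemma pr_n_surj (u : Tbar_n K n) : exists x, u = pr_n n x.
Proof.
have [v ->] := to_quot_surj u; have [x ->] := pr_bar_surj v.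
by exists x.
Qed.

Lemma pr_n'_surj (u : Tbar_n' K n p) : exists x, u = pr_n' n p x.
Proof.
have [v ->] := to_quot_surj u; have [x ->] := pr_n_surj v.
by exists x.
Qed.

Lemma pr_np_surj (u : Tbar_np K n p) : exists x, u = pr_np n p x.
Proof.
have [v ->] := to_quot_surj u; have [x ->] := pr_n'_surj v.
by exists x.
Qed.

Lemma pr_npd_surj (u : Tbar_npd K n p j d) : exists x, u = pr_npd n p j d x.
Proof.
have [v ->] := to_quot_surj u; have [x ->] := pr_np_surj v.
by exists x.
Qed.

Lemma ker_pr_npd x : pr_npd n p j d x = 0 <-> ideal_gen tower_relations x.
Proof.
have kbar y : pr_bar y = 0 <-> ideal_gen lyndon_relations y.
  exact: to_quot_eq0.
have kn y : pr_n n y = 0 <->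
    ideal_gen (lyndon_relations `|` [set g ^+ n - 1]) y.
  apply: (ker_to_quot pr_bar_surj kbar).
  by rewrite image_set1 rmorphB rmorphXn rmorph1.
have kn' y : pr_n' n p y = 0 <->
    ideal_gen (lyndon_relations `|` [set g ^+ n - 1] `|` [set E p.-1]) y.
  by apply: (ker_to_quot pr_n_surj kn); rewrite image_set1.
have knp y : pr_np n p y = 0 <-> ideal_gen (lyndon_relations
    `|` [set g ^+ n - 1] `|` [set E p.-1] `|` [set h ^+ p]) y.
  by apply: (ker_to_quot pr_n'_surj kn'); rewrite image_set1 rmorphXn.
apply: (ker_to_quot pr_np_surj knp).
rewrite [RHS](image_comp _ (@pr_np K n p)).
by apply: eq_imagel => k _ /=; rewrite rmorphXn.
Qed.

(** Killing [E p.-1] kills every later [E k.+1 = comm (E k) h], so among the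
    commutators of the [E k] only those with indices at most [p - 2] remain. *)
Lemma tower_relationsE x : (2 <= p)%N ->
  ideal_gen tower_relations x <-> ideal_gen (pbw_relations K n p j d) x.
Proof.
move=> p2; have pE : p.-1 = (p - 2).+1 by case: p p2 => [|[|q]] // _; rewrite subn2.
split; apply: ideal_gen_min; try exact: ideal_gen_closed.
  set J := ideal_gen _; have JJ : ideal2_closed J by exact: ideal_gen_closed.
  have [J0 JB Jl Jr] := JJ.
  have Jgen y : pbw_relations K n p j d y -> J y by exact: ideal_gen_incl.
  have JC y z : J y -> J (comm y z) by move=> Jy; apply: JB; [apply: Jr|apply: Jl].
  have JE k : (p - 2 < k)%N -> J (E k).
    elim: k => // k IH; rewrite ltnS leq_eqVlt lyndon_elt_omegaS => /orP[/eqP <-|pk].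
      by apply: Jgen; left; right.
    by apply: JC; exact: IH.
  move=> _ [[[[[w [lw cw] <-]|->]|->]|->]|[k kj <-]].
  - apply: lyndon_elt_ideal => // s t st.
    case: (leqP t (p - 2)) => [tp|pt].
      by apply: Jgen; right; exists (s, t) => //=; rewrite st.
    have := JC _ (E s) (JE _ pt) => /(JB _ _ J0).
    by rewrite sub0r /comm opprB.
  - by apply: Jgen; do 4 left; left.
  - by apply: JE; rewrite pE.
  - by apply: Jgen; do 4 left; right.
  - by apply: Jgen; do 3 left; right; exists k.
set J := ideal_gen _; have [J0 JB Jl Jr] : ideal2_closed J by exact: ideal_gen_closed.
have Jgen y : tower_relations y -> J y by exact: ideal_gen_incl.
move=> _ [[[[[->|->]|[k kj <-]]|[s sp <-]]|->]|[[s t] /= /andP[st _] <-]].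
- by apply: Jgen; do 3 left; right.
- by apply: Jgen; left; right.
- by apply: Jgen; right; exists k.
- by rewrite lyndon_elt_omega_rel.
- rewrite -[_ - _]/(comm (E (p - 2)) h) -lyndon_elt_omegaS -pE.
  by apply: Jgen; do 2 left; right.
apply: Jgen; do 4 left.
exists (omega s ++ omega t); last exact: lyndon_elt_omega2.
split; first exact: lyndon_omega2.
by rewrite count_cat; exact: (@leq_add 1 1 _ _ (leq_addr _ 1) (leq_addr _ 1)).
Qed.

End Relations.

(** * A truncated polynomial algebra with its monomial functionals *)

Section QuotientStep.
Variables (C : comNzRingType) (N : nat) (c : C).
Hypothesis N_gt0 : (0 < N)%N.

Let f : {poly C} := 'X^N - c%:P.

Lemma mk_monic_XnsubC : mk_monic f = f.
Proof. by rewrite /mk_monic size_XnsubC // monicXnsubC // ltnS N_gt0. Qed.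

Lemma qX_exp : in_qpoly f 'X ^+ N = in_qpoly f c%:P.
Proof.
apply/eqP; rewrite -subr_eq0 -rmorphXn -rmorphB; apply/eqP/val_inj => /=.
by rewrite mk_monic_XnsubC Pdiv.RingMonic.rmodpp // monicXnsubC.
Qed.

Lemma coef_in_qpoly_monomial (u : C) b i : (b < N)%N ->
  (polyn (in_qpoly f (u%:P * 'X^b)))`_i = u *+ (i == b).
Proof.
move=> bN; have sz : (size (u%:P * 'X^b)%R < size (mk_monic f))%N.
  rewrite mk_monic_XnsubC size_XnsubC // mul_polyC ltnS.
  by apply: leq_trans (size_scale_leq _ _) _; rewrite size_polyXn.
by rewrite (in_qpoly_small sz) coefCM coefXn mulr_natr.
Qed.

Lemma polyn_constM (a : C) (u : {poly %/ f}) :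
  polyn (in_qpoly f a%:P * u) = a *: polyn u.
Proof.
have uE : u = in_qpoly f (polyn u).
  by apply: val_inj; rewrite [RHS]in_qpoly_small // size_mk_monic.
rewrite {1}uE -rmorphM mul_polyC in_qpoly_small //.
by apply: leq_ltn_trans (size_scale_leq _ _) _; rewrite size_mk_monic.
Qed.

End QuotientStep.

(** One variable is adjoined at a time, as C[X]/(X^N - c). Independence of the
    monomials is recorded by functionals [phi e] dual to them, since extracting a
    coefficient of the new variable extends such functionals without any
    manipulation of bases. *)
Lemma truncated_polynomials (K : fieldType) (N : nat -> nat) (c : nat -> K)
    (m : nat) : (forall i, (0 < N i)%N) ->
  exists (C : comNzRingType) (iota : {rmorphism K -> C}) (x : nat -> C)
      (phi : (nat -> nat) -> {additive C -> K}),
    [/\ forall i, (i < m)%N -> x i ^+ N i = iota (c i),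
        forall e a u, phi e (iota a * u) = a * phi e u
      & forall e f, (forall i, (i < m)%N -> (f i < N i)%N) ->
          phi e (\prod_(i < m) x i ^+ f i) = [forall i : 'I_m, e i == f i]%:R].
Proof.
move=> N_gt0; elim: m => [|m [C [iota [x [phi [xN phiZ phix]]]]]].
  exists K, idfun, (fun=> 0), (fun=> idfun); split=> // e f _.
  by rewrite big_ord0; case: forallP => // -[] [].
pose f : {poly C} := 'X^(N m) - (iota (c m))%:P.
pose C' : comNzRingType := {poly %/ f}.
pose lift : {rmorphism C -> C'} := in_qpoly f \o polyC.
pose x' i := if i == m then in_qpoly f 'X else lift (x i).
have phi'_add e : zmod_morphism (fun u : C' => phi e (polyn u)`_(e m)).
  by move=> u v; rewrite -raddfB -coefB.
pose phi'_m e := GRing.isZmodMorphism.Build C' K _ (phi'_add e).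
pose phi' e : {additive C' -> K} :=
  HB.pack (fun u : C' => phi e (polyn u)`_(e m)) (phi'_m e).
exists C', (lift \o iota), x', phi'; split.
- move=> i; rewrite ltnS leq_eqVlt /x' => /orP[/eqP->|im].
    by rewrite eqxx qX_exp.
  by rewrite ltn_eqF // -rmorphXn xN.
- move=> e a u; rewrite -phiZ; congr (phi e _).
  rewrite -[LHS]/(polyn (in_qpoly f (iota a)%:P * u))`_(e m).
  by rewrite polyn_constM coefZ.
move=> e k kN.
have prodE : \prod_(i < m.+1) x' i ^+ k i =
    in_qpoly f ((\prod_(i < m) x i ^+ k i)%:P * 'X^(k m)) :> C'.
  rewrite rmorphM rmorphXn big_ord_recr [x' ord_max]/x' eqxx.
  congr (_ * _); rewrite -[RHS]/(lift _) rmorph_prod.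
  apply: eq_bigr => i _; rewrite rmorphXn; congr (_ ^+ _).
  by apply: ifF; exact: ltn_eqF (ltn_ord i).
rewrite -[LHS]/(phi e (polyn (\prod_(i < m.+1) x' i ^+ k i))`_(e m)) prodE.
rewrite coef_in_qpoly_monomial ?kN //.
have kN' i : (i < m)%N -> (k i < N i)%N by move=> im; apply/kN/ltnW.
rewrite raddfMn phix // -mulrnA mulnb; congr (nat_of_bool _)%:R.
apply/idP/idP => [/andP[/forallP H em]|/forallP H].
  apply/forallP => i; have := ltn_ord i; rewrite ltnS leq_eqVlt => /orP[/eqP -> //|im].
  exact: (H (Ordinal im)).
apply/andP; split; last exact: (H ord_max).
by apply/forallP => i; exact: (H (widen_ord (leqnSn m) i)).
Qed.

(** * Operators in a Weyl relation *)

Section WeylElements.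
Variables (K : fieldType) (p : nat) (C : comNzRingType) (iota : {rmorphism K -> C}).
Variables (B : algType C) (D H : B).
Hypothesis charK : p \in [pchar K].
Hypothesis weyl : D * H - H * D = 1.
Hypothesis Dp : D ^+ p = 0.

(** [D H - H D = 1] makes the commutator with [H] act as d/dD. *)
Lemma comm_horner_alg (q : {poly C}) :
  horner_alg D q * H - H * horner_alg D q = horner_alg D q^`().
Proof.
elim/poly_ind: q => [|q c IH]; first by rewrite deriv0 !rmorph0 mul0r mulr0 subrr.
rewrite derivMXaddC !rmorphD !rmorphM /= horner_algX horner_algC -IH.
set Q := horner_alg D q.
rewrite mulrDl mulrDr -scalerAl mul1r -scalerAr mulr1 opprD addrACA subrr addr0.
have -> : Q + (Q * H - H * Q) * D = Q * (D * H - H * D) + (Q * H - H * Q) * D.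
  by rewrite weyl mulr1.
by rewrite mulrBr mulrBl !mulrA addrA subrK.
Qed.

(** The polynomial in D whose value is exp (D delta) applied to [x k], for the
    derivation delta sending each [x k] to [x k.+1]. *)
Definition jet (x : nat -> C) k : {poly C} :=
  \poly_(i < p) (x (k + i)%N * iota (i`!%:R)^-1).

Let p_pr : prime p := pcharf_prime charK.

(** The top coefficient of [jet x k.+1] has no counterpart in the derivative; it
    involves [x (k + p)], which is 0. *)
Lemma jet_deriv x k : (forall i, (p.-1 <= i)%N -> x i = 0) ->
  (jet x k)^`() = jet x k.+1.
Proof.
move=> x0; apply/polyP => i; rewrite coef_deriv !coef_poly.
case: ltnP => [ip|pi].
  rewrite (ltnW ip) addSnnS -mulrnAr -rmorphMn; congr (_ * iota _).
  have i1 : i.+1%:R != 0 :> K.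
    by rewrite -(dvdn_pcharf charK) gtnNdvd.
  by rewrite factS natrM invfM -mulr_natr mulrAC mulVf // mul1r.
rewrite mul0rn; case: ltnP => // _; rewrite x0 ?mul0r //.
by apply: leq_trans (leq_addl _ _); rewrite -ltnS prednK ?prime_gt0.
Qed.

(** Frobenius is additive on {poly C} and sends D^i with 0 < i to a multiple of
    D^p = 0, so only the constant coefficient survives. *)
Lemma jet_exp x k t : (p %| t)%N ->
  horner_alg D (jet x k ^+ t) = (x k ^+ t)%:A.
Proof.
have charC : p \in [pchar {poly C}] by rewrite pchar_poly (rmorph_pchar iota).
case/dvdnP => r ->; rewrite mulnC !exprM rmorphXn.
have term a i : horner_alg D (pFrobenius_aut charC (a *: 'X^i)) =
    a ^+ p *: D ^+ (i * p).
  by rewrite pFrobenius_autE exprZn -exprM linearZ rmorphXn /= horner_algX mulr_algl.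
rewrite -[jet x k ^+ p]/(pFrobenius_aut charC _) /jet poly_def rmorph_sum.
rewrite rmorph_sum (bigD1 (Ordinal (prime_gt0 p_pr))) // big1 => [|i i0].
  rewrite [LHS]/= addr0 term mul0n expr0 addn0 invr1 rmorph1 mulr1.
  by rewrite exprZn expr1n.
have ne : (i : nat) != 0%N by [].
by rewrite [LHS]term mulnC exprM Dp expr0n (negPf ne) scaler0.
Qed.

End WeylElements.

Section Matrices.
Variables (C : comNzRingType) (q : nat).
Local Notation p := q.+1.

(** Multiplication by t, and below d/dt, on C[t]/(t^p) in the basis of the powers
    of t. *)
Definition shift_mx : 'M[C]_p := \matrix_(i, j) (i == j.+1 :> nat)%:R.
Definition diff_mx : 'M[C]_p := \matrix_(i, j) (j%:R *+ (i.+1 == j :> nat)).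

Lemma shift_mxX k i j : (shift_mx ^+ k) i j = ((i : nat) == (j + k)%N)%:R.
Proof.
elim: k i j => [|k IH] i j; first by rewrite expr0 addn0 mxE.
rewrite exprSr mxE.
case: (ltnP j.+1 p) => [jp|pj].
  rewrite (bigD1 (Ordinal jp)) //= big1 ?addr0 => [|l /negPf lj].
    by rewrite IH mxE /= eqxx mulr1 addSnnS.
  by rewrite [shift_mx l j]mxE -[(l : nat) == j.+1]/(l == Ordinal jp) lj mulr0.
rewrite big1 => [|l _].
  by rewrite ltn_eqF // addnS -addSn (leq_trans (ltn_ord i)) //
    (leq_trans pj) // leq_addr.
by rewrite [shift_mx l j]mxE ltn_eqF ?mulr0 // (leq_trans (ltn_ord l)).
Qed.

Lemma shift_mx_nil : shift_mx ^+ p = 0.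
Proof.
apply/matrixP => i j; rewrite shift_mxX mxE ltn_eqF //.
by rewrite (leq_trans (ltn_ord i)) // leq_addl.
Qed.

Lemma diff_mxX_eq0 k (i j : 'I_p) : (i + k)%N != j -> (diff_mx ^+ k) i j = 0.
Proof.
elim: k i j => [|k IH] i j ij.
  by rewrite addn0 in ij; rewrite expr0 mxE -[i == j]/((i : nat) == j) (negPf ij).
 rewrite exprSr mxE big1 // => l _.
case: (i + k =P l)%N => [e|/eqP ne]; last by rewrite IH ?mul0r.
by rewrite [diff_mx l j]mxE -e -addnS (negPf ij) mulr0.
Qed.

Lemma diff_mx_nil : diff_mx ^+ p = 0.
Proof.
apply/matrixP => i j; rewrite diff_mxX_eq0 ?mxE // gtn_eqF //.
by rewrite (leq_trans (ltn_ord j)) // leq_addl.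
Qed.

(** The truncation at t^p creates one defect, the coefficient p in degree p - 1,
    and p = 0 in C. *)
Lemma weyl_mx : p \in [pchar C] -> diff_mx * shift_mx - shift_mx * diff_mx = 1.
Proof.
move=> charC; apply/matrixP => i j; rewrite !mxE.
have -> : \sum_l diff_mx i l * shift_mx l j = j.+1%:R *+ (i == j).
  case: (ltnP j.+1 p) => [jp|pj].
    rewrite (bigD1 (Ordinal jp)) //= big1 ?addr0 => [|l /negPf lj].
      by rewrite !mxE /= eqxx mulr1 eqSS.
    by rewrite [shift_mx l j]mxE -[(l : nat) == j.+1]/(l == Ordinal jp) lj mulr0.
  have -> : j.+1 = p by apply/eqP; rewrite eqn_leq ltn_ord.
  rewrite (pcharf0 charC) mul0rn big1 // => l _.
  by rewrite [shift_mx l j]mxE ltn_eqF ?mulr0 // (leq_trans (ltn_ord l)).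
have -> : \sum_l shift_mx i l * diff_mx l j = j%:R *+ (i == j).
  case: (posnP j) => [j0|j0].
    rewrite j0 mul0rn big1 // => l _.
    by rewrite [diff_mx l j]mxE j0 mulr0.
  have jp : (j.-1 < p)%N by rewrite prednK // ltnW.
  rewrite (bigD1 (Ordinal jp)) //= big1 ?addr0 => [|l /negPf lj].
    by rewrite !mxE /= prednK // eqxx mulr1n -[(i : nat) == j]/(i == j) mulr_natl.
  rewrite [diff_mx l j]mxE -{2}(prednK j0) eqSS.
  by rewrite -[(l : nat) == j.-1]/(l == Ordinal jp) lj mulr0.
by rewrite -mulrnBl -natrB // subSnn.
Qed.

End Matrices.

(** * The free algebra on g and h *)

Section FreeAlgebra.
Variable K : fieldType.
Local Notation T := (free_alg K).

Lemma gen_word (s : seq bool) :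
  mkmalgU (FMonom s) 1 = \prod_(b <- s) gen K b :> T.
Proof.
elim: s => [|b s IH].
  by rewrite big_nil -fmoneE.
rewrite big_cons -IH /gen.
rewrite [RHS]malgM_def fgmulUU mulr1; congr (mkmalgU _ _).
by rewrite /mul /= fmmulE fmuE.
Qed.

Lemma free_alg_ind (P : T -> Prop) :
  P 0 -> P 1 -> (forall x y, P x -> P y -> P (x + y)) ->
  (forall a x, P x -> P (scal a * x)) -> (forall b x, P x -> P (gen K b * x)) ->
  forall x, P x.
Proof.
move=> P0 P1 PD PZ Pg x; rewrite [x]monalgE.
apply: big_ind => // -[w] _.
have -> : mkmalgU (FMonom w) (mcoeff (FMonom w) x) =
    scal (mcoeff (FMonom w) x) * (mkmalgU (FMonom w) 1 : T) :> T.
  by rewrite [RHS]mulr_algl -mul_malgC malgM_def fgmulUU mul1m mulr1.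
apply: PZ; rewrite gen_word; elim: w => [|b w Pw]; first by rewrite big_nil.
by rewrite big_cons; apply: Pg.
Qed.

Section Universal.
Variables (B : nzRingType) (sB : {rmorphism K -> B}) (x : bool -> B).
Hypothesis sB_central : forall a b, sB a * b = b * sB a.

Let wordB (m : fmonom bool) : B := \prod_(b <- m) x b.

Fact wordB_mmorphism : mmorphism wordB.
Proof.
split=> [u v|]; last by rewrite /wordB fm1 big_nil.
by rewrite /wordB fmM big_cat.
Qed.

HB.instance Definition _ := isMultiplicative.Build (fmonom bool) B wordB wordB_mmorphism.

Lemma free_alg_universal : exists ev : {rmorphism T -> B},
  (forall b, ev (gen K b) = x b) /\ (forall a, ev (scal a) = sB a).
Proof.
have evM : monoid_morphism (mmap sB wordB).
  have [m1 m2] := @commr_mmap_is_multiplicative _ K B sB wordB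
    (fun _ _ _ => sB_central _ _).
  by split.
have evB : zmod_morphism (mmap sB wordB : T -> B) by exact: raddfB.
pose evA := GRing.isZmodMorphism.Build T B (mmap sB wordB) evB.
pose ev : {rmorphism T -> B} := HB.pack (mmap sB wordB : T -> B) evA
  (GRing.isMonoidMorphism.Build T B (mmap sB wordB) evM).
exists ev; split=> [b|a].
  rewrite [LHS]mmapU -[LHS]/(sB 1 * wordB (fmu b)) rmorph1 mul1r.
  by rewrite /wordB fmU big_seq1.
have -> : scal a = mkmalgU (mone : fmonom bool) a :> T.
  by rewrite -[scal a]mulr1 [LHS]mulr_algl -mul_malgC mulr1.
by rewrite [LHS]mmapC.
Qed.
End Universal.
End FreeAlgebra.

(** * Functionals dual to the monomials *)

Section PBWWord.
Variables (K : fieldType) (p : nat).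

Definition pbw_word (x : pbw_index p) : free_alg K :=
  gen K true ^+ x.1.1
  * (\prod_(i < p - 2) lyndon_elt K (omega (rev_ord i).+1) ^+ x.1.2 (rev_ord i))
  * gen K false ^+ x.2.

Lemma rmorph_pbw_word (A : pzRingType) (f : {rmorphism free_alg K -> A}) x :
  f (pbw_word x) = f (gen K true) ^+ x.1.1
    * (\prod_(i < p - 2)
         f (lyndon_elt K (omega (rev_ord i).+1)) ^+ x.1.2 (rev_ord i))
    * f (gen K false) ^+ x.2.
Proof.
rewrite /pbw_word !(rmorphM f) !(rmorphXn f) (rmorph_prod f).
by congr (_ * _ * _); apply: eq_bigr => i _; rewrite (rmorphXn f).
Qed.

Lemma pr_pbw_word n j d x :
  pr_npd n p j d (pbw_word x) = pbw_monomial K n p j d x.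
Proof. exact: rmorph_pbw_word. Qed.

(** The exponents of E_(omega_0), E_(omega_1), ... as one function on indices. *)
Definition pbw_exp (x : pbw_index p) (i : nat) : nat :=
  if i is k.+1 then oapp x.1.2 0%N (insub k) else x.2.

Lemma pbw_expS x (i : 'I_(p - 2)) : pbw_exp x i.+1 = x.1.2 i.
Proof. by rewrite /pbw_exp /= insubT // => ip; congr (x.1.2 _); apply: val_inj. Qed.

End PBWWord.

Section Model.
Variables (K : fieldType) (q : nat).
Local Notation p := q.+1.
Variables (C : comNzRingType) (iota : {rmorphism K -> C}) (x : nat -> C).
Hypothesis charK : p \in [pchar K].
Hypothesis x_big : forall i, (p.-1 <= i)%N -> x i = 0.

Local Notation B := 'M[C]_p.
Let H : B := shift_mx C q.
Let D : B := diff_mx C q.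
Let X k : B := horner_alg D (jet p iota x k).

Let weyl : D * H - H * D = 1.
Proof. by apply: weyl_mx; rewrite (rmorph_pchar iota). Qed.

Lemma jet_opS k : X k.+1 = X k * H - H * X k.
Proof. by rewrite /X comm_horner_alg // jet_deriv. Qed.

Lemma jet_op_big k : (p.-1 <= k)%N -> X k = 0.
Proof.
move=> pk; rewrite /X (_ : jet _ _ _ _ = 0) ?rmorph0 //.
apply/polyP => i; rewrite coef_poly coef0 x_big ?mul0r ?if_same //.
exact: leq_trans (leq_addr _ _).
Qed.

(** D kills 1, so a polynomial in D acts on 1 as its constant coefficient. *)
Lemma horner_diff_col0 (P : {poly C}) i : horner_alg D P i ord0 = P`_0 *+ (i == ord0).
Proof.
elim/poly_ind: P => [|P c _]; first by rewrite rmorph0 mxE coef0 mul0rn.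
rewrite rmorphD rmorphM /= horner_algX horner_algC coefD coefMX coefC add0r /=.
rewrite mxE mxE big1 => [|l _]; last by rewrite [D l _]mxE mulr0n mulr0.
by rewrite add0r !mxE mulr_natr.
Qed.

Lemma model_eval : exists ev : {rmorphism free_alg K -> B},
  [/\ ev (gen K true) = H, forall k, ev (lyndon_elt K (omega k)) = X k
    & forall a, ev (scal a) = (iota a)%:M].
Proof.
pose sB : {rmorphism K -> B} := scalar_mx \o iota.
have [|ev [evg evs]] := @free_alg_universal K B sB (fun b => if b then H else X 0).
  by move=> a b; exact: esym (scalar_mxC _ _).
exists ev; split; [exact: (evg true)| |exact: evs].
elim=> [|k IH]; first by rewrite lyndon_elt_omega0 evg.
by rewrite lyndon_elt_omegaS (rmorph_comm ev) IH evg jet_opS.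
Qed.

End Model.

(** The functional [psi e] reads the coefficient of the monomial [e] in the image
    of 1 under an element acting on C[t]/(t^p). The free variables
    are truncated at exponent p * (L + 1), a multiple of p at least L, which
    loses nothing for monomials with exponents below [L]. *)
Lemma pbw_model (K : fieldType) (p n j L : nat) (d : nat -> nat) :
  p \in [pchar K] -> (0 < n)%N -> (p %| n)%N -> (j <= p - 2)%N ->
  (forall k, (1 <= k <= j)%N -> (0 < d k)%N) ->
  exists psi : pbw_index p -> {additive free_alg K -> K},
    [/\ forall e a u, psi e (scal a * u) = a * psi e u,
        forall e u, ideal_gen (pbw_relations K n p j d) u -> psi e u = 0
      & forall e f, pbw_range n p j d e -> pbw_range n p j d f ->
          (forall i, (f.1.2 i < L)%N) ->
          psi e (pbw_word K f) = (e == f)%:R].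
Proof.
case: p => [|q] charK n0 pn jp d0; first by have := pcharf_prime charK.
set p := q.+1 in charK pn jp *; have p_pr := pcharf_prime charK.
have p1 : p.-1 = (p - 2).+1 by rewrite -subn1 -subnSK ?prime_gt1.
pose N i := if i == 0%N then n else if (i <= j)%N then (p ^ d i)%N else (p * L.+1)%N.
have N0 i : (0 < N i)%N.
  by rewrite /N; case: ifP => // _; case: ifP; rewrite ?expn_gt0.
have pN i : (p %| N i)%N.
  rewrite /N; case: ifP => // /negbT; rewrite -lt0n => i0.
  case: ifP => ij; last exact: dvdn_mulr.
  by rewrite -(prednK (d0 i _)) ?i0 // expnS dvdn_mulr.
have [C [iota [x' [phi [xN phiZ phix]]]]] :=
  truncated_polynomials (fun i => (i == 0%N)%:R : K) p.-1 N0.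
pose x i := if (i < p.-1)%N then x' i else 0.
have x_big i : (p.-1 <= i)%N -> x i = 0 by rewrite /x leqNgt; case: ltnP.
have [ev [evh evE evs]] := model_eval iota charK x_big.
have Xexp k t : (p %| t)%N -> ev (lyndon_elt K (omega k)) ^+ t = (x k ^+ t)%:A.
  move=> pt; rewrite evE -rmorphXn; apply: jet_exp => //; exact: diff_mx_nil.
have xNE k : (k < p.-1)%N -> x k ^+ N k = (k == 0%N)%:R.
  by move=> kp; rewrite /x kp xN // rmorph_nat.
have ev_rel u : ideal_gen (pbw_relations K n p j d) u -> ev u = 0.
  apply: (ideal_gen_min (ideal2_ker ev)) => {u}.
  move=> _ [[[[[->|->]|[k /andP[k1 kj] <-]]|[s sp <-]]|->]|[[s t] /= /andP[st _] <-]] /=.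
  - rewrite rmorphB rmorphXn rmorph1 -lyndon_elt_omega0 Xexp //.
    by rewrite (xNE 0%N) ?p1 // scale1r subrr.
  - by rewrite rmorphXn evh shift_mx_nil.
  - have kN : N k = (p ^ d k)%N by rewrite /N kj; case: eqP k1 => // ->.
    have kp : (k < p.-1)%N by rewrite p1 ltnS (leq_trans kj).
    by rewrite rmorphXn Xexp -kN // xNE // (gtn_eqF k1) scale0r.
  - by rewrite lyndon_elt_omega_rel rmorph0.
  - rewrite -[_ - _]/(comm (lyndon_elt K (omega (p - 2))) (gen K true)).
    by rewrite -lyndon_elt_omegaS -p1 evE jet_op_big.
  - rewrite -[_ - _]/(comm _ _) (rmorph_comm ev) 2!evE -rmorph_comm.
    by rewrite /comm mulrC subrr rmorph0.
pose psi (e : pbw_index p) (u : free_alg K) := phi (pbw_exp e) (ev u (inord e.1.1) ord0).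
have psiB e : zmod_morphism (psi e).
  by move=> u v; rewrite /psi rmorphB !mxE raddfB.
pose psi_ e : {additive free_alg K -> K} :=
  HB.pack (psi e) (GRing.isZmodMorphism.Build _ _ (psi e) (psiB e)).
exists psi_; split=> [e a u|e u /ev_rel ev0|e f].
- by rewrite -[LHS]/(psi _ _) /psi rmorphM evs [_ * _]mul_scalar_mx mxE phiZ.
- by rewrite -[LHS]/(psi _ _) /psi ev0 mxE raddf0.
move=> [ea ee eb] [fa fe fb] fL; rewrite -[LHS]/(psi _ _) /psi.
pose J k := jet p iota x k.
pose Q := (\prod_(i < p - 2) J (rev_ord i).+1 ^+ f.1.2 (rev_ord i)) * J 0%N ^+ f.2.
have evQ : ev (pbw_word K f) = shift_mx C q ^+ f.1.1 * horner_alg (diff_mx C q) Q.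
  rewrite /pbw_word !rmorphM !rmorphXn evh -lyndon_elt_omega0 evE -mulrA.
  rewrite !rmorph_prod; congr (_ * (_ * _)).
  by apply: eq_bigr => i _; rewrite !rmorphXn evE.
have Q0 : Q`_0 = \prod_(i < p.-1) x' i ^+ pbw_exp f i.
  have J0 k : (k < p.-1)%N -> (J k).[0] = x' k.
    by move=> kp; rewrite horner_coef0 coef_poly addn0 invr1 rmorph1 mulr1 /x kp.
  rewrite -horner_coef0 hornerM horner_prod horner_exp J0 ?p1 //.
  rewrite big_ord_recl mulrC; congr (_ * _).
  rewrite (reindex_inj rev_ord_inj); apply: eq_bigr => i _.
  by rewrite rev_ordK horner_exp J0 ?p1 ?ltnS // lift0 pbw_expS.
have fN i : (i < p.-1)%N -> (pbw_exp f i < N i)%N.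
  case: i => [//|i]; rewrite p1 ltnS => ip.
  rewrite (pbw_expS f (Ordinal ip)) /N /=.
  case: ifP => ij; first exact: (fe (Ordinal ip)).
  by apply: leq_trans (fL _) _; rewrite mulnS (leq_trans _ (leq_addl _ _)) // leq_pmull.
rewrite evQ mxE (bigD1 ord0) //= big1 => [|l l0].
  rewrite horner_diff_col0 eqxx Q0 shift_mxX inordK // add0n addr0.
  rewrite mulr_natl raddfMn phix // -mulrnA mulnb; congr (nat_of_bool _)%:R.
  apply/idP/eqP => [/andP[/forallP eE /eqP aE]|->].
    have {}eE k : (k < p.-1)%N -> pbw_exp e k = pbw_exp f k.
      by move=> kp; exact/eqP/(eE (Ordinal kp)).
    have e0 : e.2 = f.2 by apply: (eE 0%N); rewrite p1.
    have e1 : e.1.2 = f.1.2.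
      by apply/ffunP => i; rewrite -!pbw_expS eE // p1 ltnS.
    by rewrite [e]surjective_pairing [e.1]surjective_pairing
      aE e0 e1 -!surjective_pairing.
  by rewrite eqxx andbT; apply/forallP => i.
by rewrite horner_diff_col0 (negPf l0) mulr0.
Qed.

(** * Spans and dimensions *)

Section Linspan.
Variables (K : fieldType) (V : lmodType K).
Implicit Types W : set V.

Lemma linspan0 W : linspan W 0.
Proof. by exists [::]; rewrite big_nil; split. Qed.

Lemma linspan_incl W : W `<=` linspan W.
Proof.
move=> v Wv; exists [:: (1, v)]; rewrite big_seq1 scale1r; split=> // x.
by rewrite inE => /eqP ->.
Qed.

Lemma linspanD W u v : linspan W u -> linspan W v -> linspan W (u + v).
Proof.
move=> [s [sW ->]] [t [tW ->]]; exists (s ++ t); rewrite big_cat; split=> // x.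
by rewrite mem_cat => /orP[]; [apply: sW|apply: tW].
Qed.

Lemma linspanZ W a v : linspan W v -> linspan W (a *: v).
Proof.
move=> [s [sW ->]]; exists [seq (a * x.1, x.2) | x <- s].
split=> [_ /mapP[x xs ->]|]; first exact: (sW _ xs).
by rewrite big_map scaler_sumr; apply: eq_bigr => x _; rewrite scalerA.
Qed.

Lemma linspan_ind W (P : V -> Prop) :
  P 0 -> (forall u v, P u -> P v -> P (u + v)) ->
  (forall a u, P u -> P (a *: u)) -> W `<=` P -> linspan W `<=` P.
Proof.
move=> P0 PD PZ WP v [s [sW ->]]; rewrite big_seq.
by apply: big_ind => // x xs; apply/PZ/WP/sW.
Qed.

Lemma linspan_sub W W' : W `<=` linspan W' -> linspan W `<=` linspan W'.
Proof.
move=> WW'; apply: linspan_ind => //.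
- exact: linspan0.
- by move=> u v; apply: linspanD.
- by move=> a u; apply: linspanZ.
Qed.

End Linspan.

Section CommutingProducts.
Variables (A : pzRingType) (I : eqType).
Implicit Types (F : I -> A) (r : seq I).

Lemma prod_factor0 F r i : i \in r -> F i = 0 -> \prod_(l <- r) F l = 0.
Proof.
elim: r => // a r IH; rewrite inE big_cons => /orP[/eqP <- ->|ir Fi].
  by rewrite mul0r.
by rewrite IH // mulr0.
Qed.

Lemma comm_mul_prod F r i (x : A) : uniq r -> i \in r ->
  (forall l, x * F l = F l * x) ->
  x * \prod_(l <- r) F l = \prod_(l <- r) (if l == i then x * F l else F l).
Proof.
elim: r => // a r IH /= /andP[ar ur] ir xF; rewrite !big_cons.
case: (eqVneq a i) ir => [<- _|ai]; last first.
  rewrite inE eq_sym (negPf ai) /= => ir.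
  by rewrite mulrA xF -mulrA IH.
rewrite mulrA; congr (_ * _); apply: eq_big_seq => l lr.
by case: eqP lr ar => // -> ->.
Qed.

End CommutingProducts.

Section DimensionBounds.
Variables (R : realType) (K : fieldType) (V : lmodType K).

Lemma linspan_seqE (w : seq V) v : linspan [set` w] v ->
  exists c : 'I_(size w) -> K, v = \sum_i c i *: w`_i.
Proof.
apply: (@linspan_ind _ _ _
  (fun v => exists c : 'I_(size w) -> K, v = \sum_i c i *: w`_i)).
- by exists (fun=> 0); rewrite big1 // => i _; rewrite scale0r.
- move=> _ _ [c ->] [c' ->]; exists (fun i => c i + c' i).
  by rewrite -big_split; apply: eq_bigr => i _; rewrite scalerDl.
- move=> a _ [c ->]; exists (fun i => a * c i).
  by rewrite scaler_sumr; apply: eq_bigr => i _; rewrite scalerA.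
move=> {}v /= vw; exists (fun i => (i == index v w :> nat)%:R).
have iw : (index v w < size w)%N by rewrite index_mem.
rewrite (bigD1 (Ordinal iw)) //= eqxx scale1r nth_index // big1 ?addr0 // => i.
by rewrite -val_eqE /= => /negPf ->; rewrite scale0r.
Qed.

(** More vectors than [w] has would give a coefficient matrix with more rows
    than columns, hence with a nonzero row kernel: a linear relation. *)
Lemma free_size_le (s w : seq V) :
  family_free [set i | (i < size s)%N] (nth 0 s) ->
  (forall v, v \in s -> linspan [set` w] v) -> (size s <= size w)%N.
Proof.
move=> sfree sw; rewrite leqNgt; apply/negP => ws.
have /choice[c cE] (i : 'I_(size s)) : exists c : 'I_(size w) -> K,
    s`_i = \sum_l c l *: w`_l.
  by apply/linspan_seqE/sw/mem_nth.
pose M := \matrix_(i < size s, l < size w) c i l.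
have : kermx M != 0.
  rewrite kermx_eq0 -row_leq_rank -ltnNge.
  exact: leq_ltn_trans (rank_leq_col M) ws.
case/rowV0Pn => u /sub_kermxP uM /rV0Pn[i0 ui0].
pose a i := if insub i is Some i' then u 0 (i' : 'I_(size s)) else 0.
have aE (i : 'I_(size s)) : a i = u 0 i by rewrite /a valK.
have aS : \sum_(i <- iota 0 (size s)) a i *: s`_i = 0.
  have -> : iota 0 (size s) = index_iota 0 (size s) by rewrite /index_iota subn0.
  rewrite big_mkord.
  rewrite (eq_bigr (fun i : 'I__ => \sum_l (u 0 i * M i l) *: w`_l)) => [|i _].
    rewrite exchange_big big1 // => l _; rewrite -scaler_suml.
    by have /matrixP/(_ 0 l) := uM; rewrite !mxE => ->; rewrite scale0r.
  rewrite aE cE scaler_sumr; apply: eq_bigr => l _.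
  by rewrite scalerA mxE.
have in_iota i : i \in iota 0 (size s) -> (i < size s)%N by rewrite mem_iota.
have := sfree _ a (iota_uniq _ _) in_iota aS i0.
rewrite mem_iota /= add0n => /(_ (ltn_ord i0)) a0.
by move: ui0; rewrite -aE a0 eqxx.
Qed.

Lemma vdim_le (W : set V) (w : seq V) :
  W `<=` linspan [set` w] -> (vdim R W <= (size w)%:R%:E)%E.
Proof.
move=> Ww; apply: ge_ereal_sup => _ [s [sW sfree] <-].
by rewrite lee_fin ler_nat; apply: free_size_le => // v /sW/Ww.
Qed.

Lemma vdim_ge (W : set V) (s : seq V) : (forall v, v \in s -> W v) ->
  family_free [set i | (i < size s)%N] (nth 0 s) ->
  ((size s)%:R%:E <= vdim R W)%E.
Proof. by move=> sW sf; apply: ereal_sup_ubound; exists s. Qed.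

Lemma vdim_ge0 (W : set V) : (0 <= vdim R W)%E.
Proof. by apply: (@vdim_ge W [::]) => // s c _ sD _ i /sD. Qed.

End DimensionBounds.

Section GKBounds.
Variables (R : realType) (K : fieldType) (A : pzAlgType K) (q : nat).

Local Notation ratio X m :=
  (lne (vdim R (growth (A := A) X m)) * ((ln m%:R)^-1)%:E)%E.

Let ln_gt0' m : (2 <= m)%N -> 0 < ln m%:R :> R.
Proof. by move=> m2; apply: ln_gt0; rewrite ltr1n. Qed.

Lemma GKdim_ge (X : seq A) :
  (forall m, (0 < m)%N -> ((m ^ q)%:R%:E <= vdim R (growth X m))%E) ->
  (q%:R%:E <= GKdim R A)%E.
Proof.
move=> HX; apply: (@le_trans _ _ (limn_esup (fun m => ratio X m))); last first.
  by apply: ereal_sup_ubound; exists X.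
apply: le_ereal_inf_tmp => _ [U [M _ MU] <-].
apply: (@le_trans _ _ (ratio X (maxn 2 M))); last first.
  by apply: ereal_sup_ubound; exists (maxn 2 M) => //; apply: MU => /=; exact: leq_maxr.
set m := maxn 2 M; have m2 : (2 <= m)%N by exact: leq_maxl.
have m0 : (0 < m)%N by exact: ltnW.
rewrite lee_pdivlMr ?ln_gt0' // -EFinM.
have <- : lne (m ^ q)%:R%:E = (q%:R * ln m%:R)%:E :> \bar R.
  by rewrite lne_EFin ?ltr0n ?expn_gt0 ?m0 // natrX lnXn ?ltr0n // mulr_natl.
by rewrite lee_lne ?HX // in_itv /= leey andbT ?vdim_ge0 // lee_fin ler0n.
Qed.

(** The constant only contributes ln c / ln m, which tends to 0. *)
Lemma GKdim_le :
  (forall X : seq A, exists c : nat, forall m, (0 < m)%N ->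
     (vdim R (growth X m) <= (c * m ^ q)%:R%:E)%E) ->
  (GKdim R A <= q%:R%:E)%E.
Proof.
move=> HX; apply: ge_ereal_sup => _ [X _ <-]; have {HX}[c Hc] := HX X.
apply/lee_addgt0Pr => e e0.
pose M := maxn 2 (Num.truncn (expR (ln c.+1%:R / e))).+1.
apply: (@le_trans _ _ (ereal_sup ((fun m => ratio X m) @` [set m | (M <= m)%N]))).
  by apply: ereal_inf_lbound; exists [set m | (M <= m)%N] => //; exists M.
apply: ge_ereal_sup => _ [m /= Mm <-].
have m2 : (2 <= m)%N by apply: leq_trans Mm; exact: leq_maxl.
have m0 : (0 < m)%N by exact: ltnW.
have lnc : ln c.+1%:R <= e * ln m%:R :> R.
  rewrite mulrC -ler_pdivrMr // -[X in X <= _]expRK ler_ln ?posrE ?expR_gt0 ?ltr0n //.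
  apply/ltW/(lt_le_trans (Num.Theory.truncnS_gt _)).
  by rewrite ler_nat (leq_trans _ Mm) // leq_maxr.
rewrite lee_pdivrMr ?ln_gt0' // -EFinD -EFinM.
apply: (@le_trans _ _ (lne (c.+1 * m ^ q)%:R%:E)).
  rewrite lee_lne ?in_itv /= ?leey ?vdim_ge0 ?lee_fin ?ler0n //.
  apply: le_trans (Hc m m0) _.
  by rewrite lee_fin ler_nat leq_mul2r leqnSn orbT.
rewrite lne_EFin ?ltr0n ?muln_gt0 ?expn_gt0 ?m0 // lee_fin natrM natrX.
rewrite lnM ?posrE ?exprn_gt0 ?ltr0n // lnXn ?ltr0n // mulrDl mulr_natl.
by rewrite addrC lerD2l.
Qed.

End GKBounds.

(** * Counting exponents *)

Section Box.
Variable m : nat.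

Definition box (bnd : 'I_m -> nat) : seq {ffun 'I_m -> nat} :=
  [seq [ffun i => nat_of_ord (F i)] | F : {dffun forall i, 'I_(bnd i)}].

Lemma mem_box bnd e : (e \in box bnd) = [forall i, e i < bnd i]%N.
Proof.
apply/mapP/forallP => [[F _ ->] i|H]; first by rewrite ffunE.
exists [ffun i => Ordinal (H i)] => //; first by rewrite mem_enum.
by apply/ffunP => i; rewrite !ffunE.
Qed.

Lemma box_uniq bnd : uniq (box bnd).
Proof.
rewrite map_inj_uniq ?enum_uniq // => F G /ffunP FG; apply/ffunP => i.
by apply: val_inj; have := FG i; rewrite !ffunE.
Qed.

Lemma size_box bnd : size (box bnd) = (\prod_i bnd i)%N.
Proof.
rewrite size_map -cardE card_dep_ffun foldrE big_map big_enum /=.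
by apply: eq_bigr => i _; rewrite card_ord.
Qed.

End Box.

Lemma leq_expl a b q : (a <= b)%N -> (a ^ q <= b ^ q)%N.
Proof. by move=> ab; elim: q => // q IH; rewrite !expnS leq_mul. Qed.

Lemma prod_ord_if (m j : nat) (a : nat -> nat) b : (j <= m)%N ->
  (\prod_(i < m) (if (i < j)%N then a i else b) =
   (\prod_(i < j) a i) * b ^ (m - j))%N.
Proof.
move=> jm; rewrite -(big_mkord xpredT (fun i => if (i < j)%N then a i else b)).
rewrite (big_cat_nat (leq0n j) jm) /=; congr (_ * _)%N.
  by rewrite big_mkord; apply: eq_bigr => i _; rewrite ltn_ord.
rewrite -prod_nat_const_nat; apply: eq_big_nat => i /andP[ji _].
by rewrite ltnNge ji.
Qed.

Lemma family_free_nth (K : fieldType) (V : lmodType K) (I : eqType) (D : set I)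
    (b : I -> V) (l : seq I) : uniq l -> (forall i, i \in l -> D i) ->
  family_free D b ->
  family_free [set k | (k < size (map b l))%N] (nth 0 (map b l)).
Proof.
case: l => [|i0 l'] ul lD bfree s c us sl; first by move=> _ k /sl.
set l := i0 :: l' in ul lD sl *; rewrite /= in sl.
have sl' k : k \in s -> (k < size l)%N by move/sl; rewrite /= size_map.
have us' : uniq [seq nth i0 l k | k <- s].
  rewrite map_inj_in_uniq // => k k' /sl' kl /sl' kl' /eqP.
  by rewrite nth_uniq // => /eqP.
move=> s0 k ks.
have := bfree _ (fun i => c (index i l)) us' _ _ (nth i0 l k).
rewrite index_uniq ?sl' //; apply; last exact: map_f.
  by move=> _ /mapP[k' /sl' kl ->]; apply/lD/mem_nth.
rewrite big_map -[RHS]s0; apply: eq_big_seq => k' /sl' kl.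
by rewrite index_uniq // (nth_map i0).
Qed.

(** * The degree filtration *)

(** The elements [h] and [x k] are abstract, so that the rewriting uses nothing
    but their relations. *)
Section Filtration.
Variables (K : fieldType) (A : pzAlgType K) (p n j : nat) (d : nat -> nat).
Variables (h : A) (x : nat -> A).
Hypothesis p_ge2 : (2 <= p)%N.
Hypothesis n_gt0 : (0 < n)%N.
Hypothesis hp : h ^+ p = 0.
Hypothesis gn : x 0 ^+ n = 1.
Hypothesis xd : forall k, (1 <= k <= j)%N -> x k ^+ (p ^ d k)%N = 0.
Hypothesis xh : forall k, x k * h = h * x k + x k.+1.
Hypothesis x_big : forall k, (p - 2 < k)%N -> x k = 0.
Hypothesis xC : forall s t, x s * x t = x t * x s.

Definition xprod (e : {ffun 'I_(p - 2) -> nat}) : A :=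
  \prod_(i < p - 2) x (rev_ord i).+1 ^+ e (rev_ord i).

Definition mono (f : pbw_index p) : A := h ^+ f.1.1 * xprod f.1.2 * x 0 ^+ f.2.

Definition weight (f : pbw_index p) : nat :=
  (f.1.1 + (\sum_(i < p - 2) f.1.2 i) + f.2)%N.

Definition filt N : set (vect_of A) :=
  linspan (V := vect_of A) ((mono : _ -> vect_of A) @`
    [set f | pbw_range n p j d f /\ (weight f <= N)%N]).

Lemma filt0 N : filt N 0.
Proof. exact: (@linspan0 K (vect_of A)). Qed.

Lemma filtD N (u v : A) : filt N u -> filt N v -> filt N (u + v).
Proof. exact: (@linspanD K (vect_of A)). Qed.

Lemma filtZ N a (u : A) : filt N u -> filt N (scal a * u).
Proof. exact: (@linspanZ K (vect_of A)). Qed.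

Lemma filt_ind N (P : A -> Prop) :
  P 0 -> (forall u v, P u -> P v -> P (u + v)) ->
  (forall a u, P u -> P (scal a * u)) ->
  (forall f, pbw_range n p j d f -> (weight f <= N)%N -> P (mono f)) ->
  forall u, filt N u -> P u.
Proof.
move=> P0 PD PZ Pm; apply: (@linspan_ind K (vect_of A)) => //.
by move=> _ [f [fr fN] <-]; apply: Pm.
Qed.

Lemma filt_mono f N : pbw_range n p j d f -> (weight f <= N)%N ->
  filt N (mono f).
Proof. by move=> fr fN; apply: linspan_incl; exists f. Qed.

Lemma filt_sub M N : (M <= N)%N -> filt M `<=` filt N.
Proof.
move=> MN; apply: filt_ind; [exact: filt0|exact: filtD|exact: filtZ|] => f fr fM.
apply: filt_mono => //.
exact: leq_trans MN.
Qed.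

Lemma filt_mul_gen (y : A) M N :
  (forall f, pbw_range n p j d f -> (weight f <= M)%N -> filt N (y * mono f)) ->
  forall v : A, filt M v -> filt N (y * v).
Proof.
move=> H; apply: filt_ind => //.
- by rewrite mulr0; apply: filt0.
- by move=> u v Hu Hv; rewrite mulrDr; apply: filtD.
by move=> a u Hu; rewrite mulrA -scal_central -mulrA; apply: filtZ.
Qed.

(** Either the exponent of [h] stays in range or [h ^+ p = 0] appears. *)
Lemma filt_h N (v : A) : filt N v -> filt N.+1 (h * v).
Proof.
apply: filt_mul_gen v => -[[a e] b] [/= ap er bn] wf.
rewrite /mono /= !mulrA -exprS -mulrA.
case: (ltnP a.+1 p) => [ap'|pa].
  by rewrite mulrA; apply: (@filt_mono (a.+1, e, b)).
have -> : a.+1 = p by apply/eqP; rewrite eqn_leq ap.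
by rewrite hp mul0r; apply: filt0.
Qed.

Lemma xprod_comm e k : x k * xprod e = xprod e * x k.
Proof.
rewrite /xprod; apply: (big_ind (fun y => x k * y = y * x k)).
- by rewrite mulr1 mul1r.
- by move=> y z Hy Hz; rewrite mulrA Hy -mulrA Hz mulrA.
by move=> i _; apply: commrX; apply: xC.
Qed.

(** Without a factor [h] the monomial is a product of commuting elements: one
    exponent grows by 1, and leaves its range only through [x 0 ^+ n = 1] or
    through a vanishing power. *)
Lemma filt_x0 k f N : pbw_range n p j d f -> f.1.1 = 0%N -> (weight f <= N)%N ->
  filt N.+1 (x k * mono f).
Proof.
case: f => [[a e] b] [/= ap er bn] a0; rewrite {}a0 in ap *.
rewrite /weight /= add0n => wf.
rewrite /mono /= mul1r.
case: k => [|k].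
  rewrite mulrA xprod_comm -mulrA -exprS.
  case: (ltnP b.+1 n) => [bn'|nb].
    rewrite -[xprod e]mul1r; apply: (@filt_mono (0%N, e, b.+1)) => //.
    by rewrite /weight /= add0n addnS ltnS.
  have -> : b.+1 = n by apply/eqP; rewrite eqn_leq bn.
  rewrite gn -[xprod e]mul1r; apply: (@filt_mono (0%N, e, 0%N)) => //.
  by rewrite /weight /= add0n addn0 (leq_trans _ (leqnSn N)) //
    (leq_trans _ wf) // leq_addr.
case: (leqP k.+1 (p - 2)) => [kp|pk]; last first.
  by rewrite x_big // mul0r; apply: filt0.
pose i := Ordinal kp; pose e' := [ffun l => (e l + (l == i))%N].
have xE : x k.+1 * xprod e = xprod e'.
  rewrite /xprod (@comm_mul_prod _ _ _ _ (rev_ord i)) ?index_enum_uniq ?mem_index_enum //.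
    apply: eq_bigr => l _; rewrite ffunE (inv_eq rev_ordK).
    by case: eqP => [->|_]; rewrite ?addn0 // addn1 rev_ordK exprS.
  by move=> l; apply: commrX; apply: xC.
rewrite mulrA xE.
have we' : (\sum_(l < p - 2) e' l = (\sum_(l < p - 2) e l).+1)%N.
  rewrite (eq_bigr (fun l => e l + (l == i))%N) => [|l _]; last by rewrite ffunE.
  rewrite big_split -[RHS]addn1; congr (_ + _)%N.
  by rewrite (bigD1 i) //= eqxx big1 // => l /negPf ->.
case: (boolP ((i < j) && (p ^ d i.+1 <= e' i)))%N => [/andP[ij pe]|ok].
  suff -> : xprod e' = 0 by rewrite mul0r; apply: filt0.
  apply: (@prod_factor0 _ _ _ _ (rev_ord i)); first exact: mem_index_enum.
  by rewrite rev_ordK -(subnKC pe) exprD xd ?mul0r.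
rewrite -[xprod e']mul1r; apply: (@filt_mono (0%N, e', b)); last first.
  by rewrite /weight /= add0n we' addSn ltnS.
split=> //= l; case: (eqVneq l i) => [->|li] lj.
  by move: ok; rewrite lj /= -ltnNge.
by rewrite ffunE (negPf li) addn0 er.
Qed.

(** Induction on the exponent of [h]: moving [x k] past one [h] leaves
    [x k.+1], with one [h] fewer and hence no increase of degree. *)
Lemma filt_x k N (v : A) : filt N v -> filt N.+1 (x k * v).
Proof.
apply: filt_mul_gen v => -[[a e] b].
elim: a N k => [|a IH] N k fr wf; first exact: filt_x0.
have monoS : mono (a.+1, e, b) = h * mono (a, e, b).
  by rewrite /mono /= exprS !mulrA.
have fr' : pbw_range n p j d (a, e, b).
  by case: fr => /= ap er bn; split=> //=; apply: ltnW.
case: N wf => [|N] wf; first by rewrite /weight /= !addSn in wf.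
have wf' : (weight (a, e, b) <= N)%N by rewrite /weight /= !addSn in wf *.
rewrite monoS mulrA xh mulrDl -mulrA; apply: filtD.
  by apply/filt_h/IH.
by apply: filt_sub (leqnSn _) _ _; apply: IH.
Qed.

Lemma filtX (y : A) : (forall N (v : A), filt N v -> filt N.+1 (y * v)) ->
  forall m N (v : A), filt N v -> filt (m + N) (y ^+ m * v).
Proof.
move=> Hy; elim=> [|m IH] N v Nv; first by rewrite mul1r.
by rewrite exprS -mulrA addSn; apply/Hy/IH.
Qed.

Lemma filtM M N (u v : A) : filt M u -> filt N v -> filt (M + N) (u * v).
Proof.
move=> Mu Nv; move: u Mu; apply: filt_ind.
- by rewrite mul0r; apply: filt0.
- by move=> u w Hu Hw; rewrite mulrDl; apply: filtD.
- by move=> a u Hu; rewrite -mulrA; apply: filtZ.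
move=> [[a e] b] fr fM; apply: filt_sub (leq_add fM (leqnn N)) _ _.
rewrite /mono /weight /= -!mulrA -!addnA; apply: filtX; first exact: filt_h.
have : filt (b + N) (x 0 ^+ b * v) by apply: filtX => // ? ?; apply: filt_x.
move: (x 0 ^+ b * v) (b + N)%N => w {}N {}Nv.
rewrite /xprod (reindex_inj rev_ord_inj) /=.
apply: (big_ind2 (fun y (m : nat) => forall N w, filt N w -> filt (m + N) (y * w))) => //.
- by move=> L y Ly; rewrite mul1r.
- move=> y1 m1 y2 m2 H1 H2 L z Lz; rewrite -mulrA -addnA.
  by apply/H1/H2.
by move=> i _ L y; apply: filtX => ? ?; apply: filt_x.
Qed.

Lemma filt1 : filt 0 1.
Proof.
have -> : (1 : A) = mono (0%N, [ffun=> 0%N], 0%N).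
  by rewrite /mono /= /xprod big1 ?mulr1 // => i _; rewrite ffunE.
apply: filt_mono; last by rewrite /weight /= big1 // => i _; rewrite ffunE.
split=> //=; first exact: leq_trans p_ge2.
by move=> i _; rewrite ffunE expn_gt0 (leq_trans _ p_ge2).
Qed.

Lemma filt_prod M m (s : seq A) : (forall u, u \in s -> filt M u) ->
  (size s <= m)%N -> filt (m * M) (\prod_(u <- s) u).
Proof.
elim: s m => [|u s IH] m sM.
  by move=> _; rewrite big_nil; apply: filt_sub filt1.
case: m => // m sm; rewrite big_cons mulSn; apply: filtM.
  by apply: sM; rewrite mem_head.
by apply: IH => // v vs; apply: sM; rewrite inE vs orbT.
Qed.

Lemma prodM_comm (F G : 'I_(p - 2) -> A) : (forall k l, F k * G l = G l * F k) ->
  (\prod_i F i) * (\prod_i G i) = \prod_i (F i * G i).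
Proof.
move=> FG; elim: (index_enum _) => [|i r IH]; rewrite ?big_nil ?mulr1 // !big_cons -IH.
rewrite !mulrA; congr (_ * _); rewrite -!mulrA; congr (_ * _).
by elim: r {IH} => [|k r IH]; rewrite ?big_nil ?mul1r ?mulr1 //
  !big_cons mulrA -FG -!mulrA IH.
Qed.

Lemma xprodD e e' : xprod e * xprod e' = xprod [ffun i => (e i + e' i)%N].
Proof.
rewrite /xprod prodM_comm => [|k l].
  by apply: eq_bigr => i _; rewrite ffunE exprD.
by apply: commrX; apply: commr_sym; apply: commrX; apply: xC.
Qed.

Hypothesis filt_all : forall u : A, exists N, filt N u.

Lemma filt_seq (X : seq A) : exists M, forall u, u \in X -> filt M u.
Proof.
elim: X => [|u X [M HM]]; first by exists 0%N.
have [N HN] := filt_all u; exists (maxn N M) => v.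
rewrite inE => /orP[/eqP ->|vX]; first exact: filt_sub (leq_maxl _ _) _ HN.
exact: filt_sub (leq_maxr _ _) _ (HM _ vX).
Qed.

Lemma growth_filt (X : seq A) : exists M, forall m, growth X m `<=` filt (m * M).
Proof.
have [M HM] := filt_seq X; exists M => m.
apply: (@linspan_sub K (vect_of A)) => _ [s [sm sX] <-].
by apply: filt_prod => // u /sX; apply: HM.
Qed.

Definition filt_bound N (i : nat) := if (i < j)%N then (p ^ d i.+1)%N else N.+1.

Definition filt_index N : seq (pbw_index p) :=
  [seq (ae, b) | ae <- [seq (a, e) | a <- iota 0 p, e <- box (filt_bound N)],
                 b <- iota 0 n].

Lemma filt_span N : filt N `<=` linspan (V := vect_of A)
  [set` [seq (mono f : vect_of A) | f <- filt_index N]].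
Proof.
apply: linspan_sub => _ [[[a e] b] [[/= ap er bn] wf] <-].
apply: linspan_incl => /=; apply: map_f; apply: allpairs_f; last by rewrite mem_iota.
apply: allpairs_f; first by rewrite mem_iota.
rewrite mem_box; apply/forallP => i; rewrite /filt_bound.
case: ifP => ij; first exact: er.
rewrite ltnS (leq_trans _ wf) // /weight /= (bigD1 i) //=.
by rewrite -addnA addnC -!addnA leq_addr.
Qed.

Hypothesis j_le : (j <= p - 2)%N.

Lemma size_filt_index N : size (filt_index N) =
  (p * ((\prod_(i < j) p ^ d i.+1) * N.+1 ^ (p - 2 - j)) * n)%N.
Proof.
rewrite !size_allpairs !size_iota size_box.
by rewrite (prod_ord_if (fun i => p ^ d i.+1)%N N.+1 j_le).
Qed.

Hypothesis mono_free :
  family_free (V := vect_of A) (pbw_range n p j d) (mono : _ -> vect_of A).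

(** The squarefree monomials in the variables that are not nilpotent. *)
Definition free_generators : seq A :=
  [seq xprod e | e <- box (fun i : 'I_(p - 2) => if (i < j)%N then 1%N else 2)].

(** Split off the support: the product of the variables with a positive exponent
    is one generator, and all exponents drop by 1. *)
Lemma xprod_growth m (e : {ffun 'I_(p - 2) -> nat}) :
  (forall i, (e i < if (i < j)%N then 1 else m.+1)%N) ->
  exists s : seq A, [/\ (size s <= m)%N, {subset s <= free_generators} &
     \prod_(u <- s) u = xprod e].
Proof.
elim: m e => [|m IH] e em.
  exists [::]; split=> //; rewrite big_nil /xprod big1 // => i _.
  by have := em (rev_ord i); rewrite if_same ltnS leqn0 => /eqP ->.
have [|s [sm sX sE]] := IH [ffun i => (e i).-1].
  move=> i; rewrite ffunE; have := em i.
  by case: ifP => _; case: (e i).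
exists (xprod [ffun i => (0 < e i)%N : nat] :: s); split=> //.
- move=> u; rewrite inE => /orP[/eqP ->|]; last exact: sX.
  apply: map_f; rewrite mem_box; apply/forallP => i; rewrite ffunE.
  by have := em i; case: ifP => _; case: (e i).
rewrite big_cons sE xprodD; congr xprod; apply/ffunP => i; rewrite !ffunE.
by case: (e i).
Qed.

Lemma GKdim_filt (R : realType) : GKdim R A = (p - 2 - j)%:R%:E.
Proof.
apply/eqP; rewrite eq_le; apply/andP; split.
  apply: GKdim_le => X; have [M HM] := growth_filt X.
  exists (p * (\prod_(i < j) p ^ d i.+1) * n * M.+1 ^ (p - 2 - j))%N => m m0.
  apply: (@le_trans _ _
    (size [seq (mono f : vect_of A) | f <- filt_index (m * M)])%:R%:E).
    by apply: vdim_le; apply: subset_trans (HM m) (@filt_span _).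
  rewrite size_map size_filt_index lee_fin ler_nat -!mulnA leq_mul2l; apply/orP; right.
  rewrite leq_mul2l; apply/orP; right; rewrite mulnC leq_mul2l; apply/orP; right.
  rewrite -expnMn; apply: leq_expl.
  by rewrite mulSn mulnC -addn1 addnC leq_add2r.
apply: (@GKdim_ge _ _ _ _ free_generators) => m m0.
set bnd := fun i : 'I_(p - 2) => if (i < j)%N then 1%N else m.+1.
pose fs := [seq (0%N, e, 0%N) : pbw_index p | e <- box bnd].
have fsE : [seq (mono f : vect_of A) | f <- fs] = [seq xprod e | e <- box bnd].
  by rewrite -map_comp; apply: eq_map => e; rewrite /= /mono /= mul1r mulr1.
apply: (@le_trans _ _ (size [seq (mono f : vect_of A) | f <- fs])%:R%:E).
  rewrite 2!size_map size_box (prod_ord_if (fun=> 1%N) m.+1 j_le).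
  rewrite lee_fin ler_nat big1 // mul1n.
  exact: leq_expl.
apply: vdim_ge.
  rewrite fsE => v /mapP[e]; rewrite mem_box => /forallP em ->.
  have [s [sm sX sE]] := xprod_growth em.
  by apply: linspan_incl; exists s.
apply: (family_free_nth _ _ mono_free).
  by rewrite map_inj_uniq ?box_uniq // => e e' [].
move=> f /mapP[e]; rewrite mem_box => /forallP em ->; split=> //=.
  exact: leq_trans p_ge2.
move=> i ij; have := em i; rewrite /bnd ij => /leq_trans; apply.
by rewrite expn_gt0 (leq_trans _ p_ge2).
Qed.

End Filtration.

(** * Algebras with the given presentation *)

(** The results are proved for an abstract quotient [f] of the free algebra with
    the right kernel. *)
Section Presentation.
Variables (K : fieldType) (p n j : nat) (d : nat -> nat).
Variables (A : pzAlgType K) (f : {rmorphism free_alg K -> A}).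
Hypothesis charK : p \in [pchar K].
Hypothesis n_gt0 : (0 < n)%N.
Hypothesis p_dvd_n : (p %| n)%N.
Hypothesis j_le : (j <= p - 2)%N.
Hypothesis d_gt0 : forall k, (1 <= k <= j)%N -> (0 < d k)%N.
Hypothesis f_surj : forall u, exists x, u = f x.
Hypothesis f_scal : forall a, f (scal a) = scal a.
Hypothesis f_ker : forall x, f x = 0 <-> ideal_gen (pbw_relations K n p j d) x.

Local Notation g := (f (gen K false)).
Local Notation h := (f (gen K true)).
Local Notation x k := (f (lyndon_elt K (omega k))).

Lemma p_ge2 : (2 <= p)%N.
Proof. exact: prime_gt1 (pcharf_prime charK). Qed.

Lemma f_rel y : pbw_relations K n p j d y -> f y = 0.
Proof. by move=> Ry; apply/f_ker; apply: ideal_gen_incl. Qed.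

Lemma pres_gn : g ^+ n = 1.
Proof.
apply/eqP; rewrite -subr_eq0 -(rmorphXn f) -(rmorph1 f) -(rmorphB f).
by apply/eqP/f_rel; do 5 left.
Qed.

Lemma pres_hp : h ^+ p = 0.
Proof. by rewrite -(rmorphXn f); apply: f_rel; do 4 left; right. Qed.

Lemma pres_xd k : (1 <= k <= j)%N -> x k ^+ (p ^ d k)%N = 0.
Proof.
by move=> kj; rewrite -(rmorphXn f); apply: f_rel; do 3 left; right; exists k.
Qed.

Lemma pres_xh k : x k * h = h * x k + x k.+1.
Proof.
apply: comm_mul; rewrite lyndon_elt_omegaS.
exact: (rmorph_comm f).
Qed.

Lemma pres_x_last : x (p - 2) * h = h * x (p - 2).
Proof.
apply/eqP; rewrite -subr_eq0 -!(rmorphM f) -(rmorphB f).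
by apply/eqP/f_rel; left; right.
Qed.

Lemma pres_x_big k : (p - 2 < k)%N -> x k = 0.
Proof.
elim: k => // k IH; rewrite ltnS leq_eqVlt => /orP[/eqP <-|pk].
  have /eqP := pres_xh (p - 2); rewrite pres_x_last eq_sym.
  by rewrite -subr_eq0 addrC addKr => /eqP.
have := pres_xh k; rewrite IH // mul0r mulr0 add0r; exact: esym.
Qed.

Lemma pres_xC_lt s t : (s < t <= p - 2)%N -> x s * x t = x t * x s.
Proof.
move=> st; apply/eqP; rewrite -subr_eq0 -!(rmorphM f) -(rmorphB f).
by apply/eqP/f_rel; right; exists (s, t).
Qed.

Lemma pres_xC s t : x s * x t = x t * x s.
Proof.
case: (leqP s (p - 2)) => sp; last by rewrite (pres_x_big sp) mul0r mulr0.
case: (leqP t (p - 2)) => tp; last by rewrite (pres_x_big tp) mul0r mulr0.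
case: (ltngtP s t) => [st|ts|-> //]; first by apply: pres_xC_lt; rewrite st.
by apply/esym/pres_xC_lt; rewrite ts.
Qed.

Let X k := x k.

Lemma f_pbw_word (e : pbw_index p) : f (pbw_word K e) = mono h X e.
Proof. by rewrite rmorph_pbw_word /mono /X lyndon_elt_omega0. Qed.

Lemma pres_filt_all (u : A) : exists N, filt p n j d h X N u.
Proof.
have [y ->] := f_surj u;
elim/free_alg_ind: y => [||y z [M HM] [N HN]|a y [N HN]|b y [N HN]].
- by exists 0%N; rewrite (rmorph0 f); apply: filt0.
- by exists 0%N; rewrite (rmorph1 f); apply: filt1 => //; exact: p_ge2.
- exists (maxn M N); rewrite (rmorphD f); apply: filtD.
    exact: filt_sub (leq_maxl _ _) _ HM.
  exact: filt_sub (leq_maxr _ _) _ HN.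
- by exists N; rewrite (rmorphM f) f_scal; apply: filtZ.
exists N.+1; rewrite (rmorphM f); case: b.
  by apply: filt_h => //; exact: pres_hp.
rewrite -lyndon_elt_omega0 -/(X 0).
have X0n : X 0 ^+ n = 1 by rewrite /X lyndon_elt_omega0; exact: pres_gn.
exact: (filt_x n_gt0 pres_hp X0n pres_xd pres_xh pres_x_big pres_xC).
Qed.

(** The model may depend on the finite family considered: [L] exceeds all
    exponents that occur in it. *)
Lemma pres_free :
  family_free (V := vect_of A) (pbw_range n p j d) (mono h X : _ -> vect_of A).
Proof.
move=> s c us sr s0 e es.
pose L := (\max_(e <- s) \max_(i < p - 2) e.1.2 i).+1.
have [psi [psiZ psi0 psi_word]] := pbw_model L charK n_gt0 p_dvd_n j_le d_gt0.
have : f (\sum_(e <- s) scal (c e) * pbw_word K e) = 0.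
  rewrite (rmorph_sum f) -[RHS]s0; apply: eq_bigr => e' _.
  by rewrite (rmorphM f) f_scal f_pbw_word.
move=> /f_ker/(psi0 e); rewrite raddf_sum (bigD1_seq e) //= big1_seq.
  rewrite addr0 psiZ psi_word ?eqxx ?mulr1 //; try exact: sr.
  move=> i; rewrite ltnS (leq_trans _ (leq_bigmax_seq _ es _)) //.
  exact: (leq_bigmax (F := fun i => e.1.2 i)).
move=> e' /andP[ee' e's]; rewrite psiZ psi_word; try exact: sr.
  by rewrite eq_sym (negPf ee') mulr0.
move=> i; rewrite ltnS (leq_trans _ (leq_bigmax_seq _ e's _)) //.
exact: (leq_bigmax (F := fun i => e'.1.2 i)).
Qed.

Lemma pres_basis : family_basis (V := vect_of A) (pbw_range n p j d)
  (fun e : pbw_index p => f (pbw_word K e)).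
Proof.
rewrite (_ : (fun e => _) = mono h X); last by apply/funext => e; exact: f_pbw_word.
split; first exact: pres_free.
rewrite eqEsubset; split=> // u _; have [N HN] := pres_filt_all u.
apply: (@linspan_sub K (vect_of A)) _ HN => _ [e [er _] <-].
by apply: linspan_incl; exists e.
Qed.

Lemma pres_GKdim (R : realType) : GKdim R A = (p - 2 - j)%:R%:E.
Proof.
apply: (GKdim_filt (x := X) p_ge2 n_gt0 pres_hp _ pres_xd
  pres_xh pres_x_big pres_xC pres_filt_all j_le pres_free).
by rewrite /X lyndon_elt_omega0 pres_gn.
Qed.

End Presentation.

Unset Implicit Arguments. Set Strict Implicit.

Theorem theorem3p14 (R : realType) (K : fieldType) (p n j : nat) (d : nat -> nat)
    (charK : p \in [pchar K]) (n_ge2 : (2 <= n)%N) (p_dvd_n : (p %| n)%N)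
    (Egh_neq0 : pr_n n (lyndon_elt K (omega 1)) <> 0)
    (j_bounds : (1 <= j <= p - 2)%N)
    (d1_ge1 : (1 <= d 1)%N)
    (d_mono : forall k, (1 <= k < j)%N -> (d k <= d k.+1)%N) :
  let A := Tbar_npd K n p j d in
  let g : A := pr_npd n p j d (gen K false) in
  let h : A := pr_npd n p j d (gen K true) in
  let E k : A := pr_npd n p j d (lyndon_elt K (omega k)) in
  [/\ GKdim R A = (p - 2 - j)%:R%:E,
      family_basis (V := vect_of A) (pbw_range n p j d)
        (pbw_monomial K n p j d),
      [/\ g ^+ n = 1,
          forall k, (1 <= k <= j)%N -> E k ^+ (p ^ d k)%N = 0
        & h ^+ p = 0],
      [/\ forall s, (s < p - 2)%N -> E s * h = h * E s + E s.+1,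
          E (p - 2)%N * h = h * E (p - 2)%N
        & forall s t, (s < t <= p - 2)%N -> E s * E t = E t * E s]
    & forall x : free_alg K,
        pr_npd n p j d x = 0 <-> ideal_gen (pbw_relations K n p j d) x].
Proof.
move=> A g h E; have /andP[j1 jp] := j_bounds.
have n_gt0 : (0 < n)%N by apply: ltnW.
have d_gt0 k : (1 <= k <= j)%N -> (0 < d k)%N.
  elim: k => // k IH /andP[_ kj]; case: k kj IH => [//|k] kj IH.
  by apply: leq_trans (d_mono k.+1 kj); apply: IH; rewrite /= ltnW.
have ker y : pr_npd n p j d y = 0 <-> ideal_gen (pbw_relations K n p j d) y.
  apply: iff_trans (ker_pr_npd _ _ _ _ _) _.
  by apply: tower_relationsE; exact: p_ge2 charK.
pose f : {rmorphism free_alg K -> A} := pr_npd n p j d.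
have f_surj : forall u, exists x, u = f x := @pr_npd_surj K n p j d.
have f_scal a : f (scal a) = scal a by [].
have monoE : pbw_monomial K n p j d = fun e : pbw_index p => f (pbw_word K e).
  by apply/funext => e; apply/esym; exact: pr_pbw_word.
split; [| | | |exact: ker].
- exact: (pres_GKdim charK n_gt0 p_dvd_n jp d_gt0 f_surj f_scal ker).
- rewrite monoE.
  exact: (pres_basis charK n_gt0 p_dvd_n jp d_gt0 f_surj f_scal ker).
- split; [exact: (pres_gn ker)|exact: (pres_xd ker)|exact: (pres_hp ker)].
split; [|exact: (pres_x_last ker)|exact: (pres_xC_lt ker)].
by move=> s _; exact: (pres_xh f).
Qed.
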